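(* Let $h(x,y)=Ay-b$, let the standing assumptions (S1)--(S3) of the context hold, and let $\delta=\Theta(\epsilon)$ with $\delta\le\mu_g/(2l_{f,1})$. Let $x_0\in\mathbb{R}^{d_x}$ be a given initial point such that LICQ holds at $y^*(x_0)$ and at $y^*_\delta(x_0)$. There are parameters $\rho_1,\rho_2,\eta_x,\eta_y,\eta_z,\eta_u,\eta_v>0$ and a constant $\kappa>0$, all independent of $\epsilon$, such that if $\epsilon$ is sufficiently small in the sense that $\epsilon\le\kappa\min\{\Delta^\alpha,\Delta^\beta\}$, then: (a) SFLCB run with $x_t\equiv x_0$ fixed (i.e. omitting the $x$-update) finds $\hat y'=(\hat y^\top,\hat\alpha^\top)^\top,\ \hat z'=(\hat z^\top,\hat\beta^\top)^\top,\ \hat u,\ \hat v$ with $$\|\hat y-y^*_\delta(x_0)\|\le O(\delta),\ \ \|A'y'^*_\delta(x_0,\hat u)-b\|\le O(\delta),\ \ \|A'\hat y'-b\|\le O(\delta),\ \ \|\hat u-u^*_\delta(x_0)\|\le O(\delta),$$ $$\|\hat z-z^*(x_0)\|\le O(\delta),\ \ \|A'z'^*(x_0,\hat v)-b\|\le O(\delta),\ \ \|A'\hat z'-b\|\le O(\delta),\ \ \|\hat v-v^*(x_0)\|\le O(\delta)$$ with complexity $O(\epsilon^{-2})$. (b) Setting $y_0'=\hat y'$, $z_0'=\hat z'$, $u_0=\hat u$, $v_0=\hat v$ and running SFLCB from the initial points $x_0,y_0',z_0',u_0,v_0$, one finds an $\epsilon$-stationary point of $\Phi_\delta$ (some iterate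 satisfies $\|\nabla\Phi_\delta(x_t)\|\le\epsilon$) with complexity $O(\epsilon^{-3})$. Hence the total complexity is $O(\epsilon^{-3}+\epsilon^{-2})=O(\epsilon^{-3})$.
   Context: $f,g:\mathbb{R}^{d_x}\times\mathbb{R}^{d_y}\to\mathbb{R}$ are continuously differentiable; $A\in\mathbb{R}^{d_h\times d_y}$ (not necessarily of full row rank), $b\in\mathbb{R}^{d_h}$; $\mathcal{Y}(x)=\{y\in\mathbb{R}^{d_y}:Ay-b\le0\}$ (componentwise). Standing assumptions. (S1) $\mathcal{Y}(x)$ is nonempty, closed and convex, and $\Phi(x)=f(x,y^*(x))$, with $y^*(x)=\arg\min_{y\in\mathcal{Y}(x)}g(x,y)$, satisfies $\inf_{x\in\mathbb{R}^{d_x}}\Phi(x)>-\infty$. (S2) $f,\nabla f,\nabla g$ are Lipschitz on $\mathbb{R}^{d_x}\times\mathbb{R}^{d_y}$ with constants $l_{f,0},l_{f,1},l_{g,1}$. (S3) For each $x$, $g(x,\cdot)$ is $\mu_g$-strongly convex on $\mathbb{R}^{d_y}$, $\mu_g>0$. Notation. $z^*(x)=y^*(x)$; $g_\delta=\delta f+g$; $y^*_\delta(x)=\arg\min_{y\in\mathcal{Y}(x)}g_\delta(x,y)$; $$\Phi_\delta(x)=\min_{y\in\mathcal{Y}(x)}\max_{z\in\mathcal{Y}(x)}\Big\{f(x,y)+\tfrac1\delta[g(x,y)-g(x,z)]\Big\}.$$ LICQ holds at $y\in\mathcal{Y}(x)$ if the rows $A_i$ of $A$ with $i$ active at $y$ (i.e.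 $(Ay-b)_i=0$) are linearly independent. $u^*_\delta(x_0)$ and $v^*(x_0)$ are the (under LICQ unique) Lagrange multipliers in $\mathbb{R}^{d_h}_+$ of the constraint $Ay-b\le0$ in the problems of minimizing $g_\delta(x_0,\cdot)$, respectively $g(x_0,\cdot)$, over $\mathcal{Y}(x_0)$. Let $\alpha^*_\delta(x_0)=Ay^*_\delta(x_0)-b$, $\beta^*(x_0)=Az^*(x_0)-b$, and let $\Delta^\alpha$ (resp. $\Delta^\beta$) be the minimum of $|[\alpha^*_\delta(x_0)]_i|$ (resp. $|[\beta^*(x_0)]_i|$) over the indices $i$ inactive at $y^*_\delta(x_0)$ (resp. $z^*(x_0)$), with value $+\infty$ if there is no inactive index. $\delta=\Theta(\epsilon)$ means $c_1\epsilon\le\delta\le c_2\epsilon$ for fixed $c_2\ge c_1>0$. Complexity means number of iterations; $O(\cdot)$ hides constants depending on the problem data, $c_1,c_2$, $x_0$, the starting points used in (a) and the algorithm parameters, but not on $\epsilon$. With slack variables $\alpha,\beta\in\mathbb{R}^{d_h}_-$ ($\mathbb{R}_-$ the nonpositive reals) write $y'=(y^\top,\alpha^\top)^\top$, $z'=(z^\top,\beta^\top)^\top$, $\mathcal{P}_y=\mathbb{R}^{d_y}\times\mathbb{R}_-^{d_h}$, $\Pi_{\mathcal{P}_y}$ the Euclidean projection, $A'=(A,-I)$, and $$K(x,y',z',u,v)=\delta f(x,y)+g(x,y)-g(x,z)+u^\top(A'y'-b)-v^\top(A'z'-b)+\tfrac{\rho_1}{2}\|A'y'-b\|^2-\tfrac{\rho_2}{2}\|A'z'-b\|^2.$$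 $y'^*_\delta(x,u)=\arg\min_{y'\in\mathcal{P}_y}K(x,y',z',u,v)$ (independent of $z',v$) and $z'^*(x,v)=\arg\max_{z'\in\mathcal{P}_y}K(x,y',z',u,v)$ (independent of $y',u$). Algorithm SFLCB: from initial $x_0\in\mathbb{R}^{d_x}$, $y_0',z_0'\in\mathcal{P}_y$, $u_0,v_0\in\mathbb{R}^{d_h}$, for $t=0,1,2,\dots$: $u_{t+1}=u_t+\eta_u(A'y'_t-b)$; $v_{t+1}=v_t+\eta_v(A'z'_t-b)$; $x_{t+1}=x_t-\eta_x\nabla_xK(x_t,y_t',z_t',u_{t+1},v_{t+1})$; $y'_{t+1}=\Pi_{\mathcal{P}_y}\{y'_t-\eta_y\nabla_{y'}K(x_t,y_t',z_t',u_{t+1},v_{t+1})\}$; $z'_{t+1}=\Pi_{\mathcal{P}_y}\{z'_t+\eta_z\nabla_{z'}K(x_t,y_t',z_t',u_{t+1},v_{t+1})\}$. *)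

(* Defs.v *)
From mathcomp Require Import all_boot all_order all_algebra.
From mathcomp Require Import all_classical all_reals all_analysis.
Set Implicit Arguments.
Unset Strict Implicit.
Unset Printing Implicit Defensive.
Import Order.TTheory GRing.Theory Num.Theory.
Import numFieldNormedType.Exports.
Local Open Scope classical_set_scope.
Local Open Scope ring_scope.

(* R^n is 'cV[R]_n, and R^m x R^n is 'cV[R]_(m + n): the pair (x, y) is
   col_mx x y.  The library norm on matrices is the sup norm, hence the
   separate Euclidean norm below; both induce the same topology, so the
   library's continuity and differentiability apply unchanged. *)

Definition dotv (R : realType) n (u v : 'cV[R]_n) : R :=
  \sum_i u i 0 * v i 0.

Definition enorm (R : realType) n (u : 'cV[R]_n) : R := Num.sqrt (dotv u u).

Definition grad (R : realType) n (F : 'cV[R]_n -> R) (p : 'cV[R]_n) :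
    'cV[R]_n :=
  \col_i 'D_(delta_mx i 0) F p.

Definition cont_diff (R : realType) n (F : 'cV[R]_n -> R) : Prop :=
  (forall p, differentiable F p) /\ continuous (grad F).

Definition strongly_convex (R : realType) n (mu : R) (F : 'cV[R]_n -> R) :
    Prop :=
  forall (y z : 'cV[R]_n) (s : R), 0 <= s <= 1 ->
    F (s *: y + (1 - s) *: z) <=
      s * F y + (1 - s) * F z - mu / 2 * s * (1 - s) * enorm (y - z) ^+ 2.

(* Differentiability is required because grad is a total function, with an
   unspecified value where partial derivatives do not exist. *)
Definition stationary (R : realType) n (eps : R) (F : 'cV[R]_n -> R)
    (p : 'cV[R]_n) : Prop :=
  differentiable F p /\ enorm (grad F p) <= eps.

(* get returns a default point when no minimizer (maximizer) exists; when it
   is unique, it is the value of argmin (argmax). *)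
Definition argmin (R : realType) (T : pointedType) (S : set T) (F : T -> R) :
    T :=
  get [set y | S y /\ forall z, S z -> F y <= F z].

Definition argmax (R : realType) (T : pointedType) (S : set T) (F : T -> R) :
    T :=
  get [set y | S y /\ forall z, S z -> F z <= F y].

Definition minval (R : realType) (T : pointedType) (S : set T) (F : T -> R) :
    R :=
  F (argmin S F).

Definition maxval (R : realType) (T : pointedType) (S : set T) (F : T -> R) :
    R :=
  F (argmax S F).

Definition eproj (R : realType) n (S : set 'cV[R]_n) (p : 'cV[R]_n) :
    'cV[R]_n :=
  argmin S (fun q => enorm (q - p)).

Section LowerLevel.
Context (R : realType) (dx dy dh : nat).
Implicit Types (f g G : 'cV[R]_(dx + dy) -> R) (A : 'M[R]_(dh, dy)).
Implicit Types (b : 'cV[R]_dh) (x : 'cV[R]_dx) (y : 'cV[R]_dy).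

Definition slack A b y : 'cV[R]_dh := A *m y - b.

(* The constraint h(x, y) = A y - b does not involve x, so neither does the
   feasible set. *)
Definition feasible A b : set 'cV[R]_dy :=
  [set y | forall i, slack A b y i 0 <= 0].

Definition active A b y : {set 'I_dh} := [set i | slack A b y i 0 == 0]%SET.

Definition licq A b y : Prop := free [seq row i A | i in active A b y].

Definition inactive_gap A b y : \bar R :=
  \big[Order.min/+oo%E]_(i in ~: active A b y) `|slack A b y i 0|%:E.

(* Used both with G = g and with G = gdelta f g delta. *)
Definition ystar G A b x : 'cV[R]_dy :=
  argmin (feasible A b) (fun y => G (col_mx x y)).

Definition is_multiplier G A b x (u : 'cV[R]_dh) : Prop :=
  [/\ forall i, 0 <= u i 0,
      grad (fun y => G (col_mx x y)) (ystar G A b x) + A^T *m u = 0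
    & forall i, u i 0 * slack A b (ystar G A b x) i 0 = 0].

Definition multiplier G A b x : 'cV[R]_dh := get (is_multiplier G A b x).

Definition gdelta f g (delta : R) : 'cV[R]_(dx + dy) -> R :=
  fun w => delta * f w + g w.

Definition Phi f g A b x : R := f (col_mx x (ystar g A b x)).

Definition Phi_delta f g A b (delta : R) x : R :=
  minval (feasible A b) (fun y =>
    maxval (feasible A b) (fun z =>
      f (col_mx x y) + delta^-1 * (g (col_mx x y) - g (col_mx x z)))).

End LowerLevel.

Record sflcb_params (R : realType) := SflcbParams {
  rho1 : R; rho2 : R;
  eta_x : R; eta_y : R; eta_z : R; eta_u : R; eta_v : R }.

Definition params_pos (R : realType) (c : sflcb_params R) : Prop :=
  [/\ 0 < rho1 c /\ 0 < rho2 c, 0 < eta_x c,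
      0 < eta_y c /\ 0 < eta_z c & 0 < eta_u c /\ 0 < eta_v c].

Record iterate (R : realType) (dy dh : nat) := Iterate {
  it_y : 'cV[R]_(dy + dh);
  it_z : 'cV[R]_(dy + dh);
  it_u : 'cV[R]_dh;
  it_v : 'cV[R]_dh }.

Section Sflcb.
Context (R : realType) (dx dy dh : nat).
Context (f g : 'cV[R]_(dx + dy) -> R) (A : 'M[R]_(dh, dy)) (b : 'cV[R]_dh).
Context (delta : R) (c : sflcb_params R).
Implicit Types (x : 'cV[R]_dx) (yp zp : 'cV[R]_(dy + dh)) (u v : 'cV[R]_dh).

Definition Py : set 'cV[R]_(dy + dh) :=
  [set yp | forall i, dsubmx yp i 0 <= 0].

(* A' y' - b with A' = (A, -I). *)
Definition residual yp : 'cV[R]_dh := row_mx A (- 1%:M) *m yp - b.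

Definition K x yp zp u v : R :=
  delta * f (col_mx x (usubmx yp)) + g (col_mx x (usubmx yp))
  - g (col_mx x (usubmx zp))
  + dotv u (residual yp) - dotv v (residual zp)
  + rho1 c / 2 * enorm (residual yp) ^+ 2
  - rho2 c / 2 * enorm (residual zp) ^+ 2.

(* The minimizer of K in y' does not depend on (z', v), nor the maximizer in
   z' on (y', u); these arguments are set to 0. *)
Definition yp_star x u : 'cV[R]_(dy + dh) :=
  argmin Py (fun yp => K x yp 0 u 0).

Definition zp_star x v : 'cV[R]_(dy + dh) :=
  argmax Py (fun zp => K x 0 zp 0 v).

Definition sflcb_fixed_step x (s : iterate R dy dh) : iterate R dy dh :=
  let u := it_u s + eta_u c *: residual (it_y s) in
  let v := it_v s + eta_v c *: residual (it_z s) in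
  Iterate
    (eproj Py (it_y s
       - eta_y c *: grad (fun yp => K x yp (it_z s) u v) (it_y s)))
    (eproj Py (it_z s
       + eta_z c *: grad (fun zp => K x (it_y s) zp u v) (it_z s)))
    u v.

Definition sflcb_step (p : 'cV[R]_dx * iterate R dy dh) :
    'cV[R]_dx * iterate R dy dh :=
  let: (x, s) := p in
  let s1 := sflcb_fixed_step x s in
  (x - eta_x c *:
     grad (fun w => K w (it_y s) (it_z s) (it_u s1) (it_v s1)) x,
   s1).

End Sflcb.

(* Main.v *)
From HB Require Import structures.
Require Import Defs.
From mathcomp Require Import all_boot all_order all_algebra.
From mathcomp Require Import all_classical all_reals all_analysis.
From mathcomp Require Import ring lra.
Set Implicit Arguments.
Unset Strict Implicit.
Unset Printing Implicit Defensive.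
Import Order.TTheory GRing.Theory Num.Theory.
Import numFieldNormedType.Exports.
Local Open Scope classical_set_scope.
Local Open Scope ring_scope.

(** Write [G] for [g] or [gd = delta f + g]; both are strongly convex in [y] and
    smooth, with moduli that do not depend on [delta]. For each of the two
    lower-level problems, the augmented Lagrangian [aug_lag] of the formulation
    with slack variables is strongly convex on [Py], and its minimum over [Py]
    defines a concave dual function with Lipschitz gradient [dual_residual]. The
    iteration alternates an inexact ascent step for the dual and a projected
    gradient step for the Lagrangian, so one expects the sum [merit] of the two
    gaps, Lagrangian minus dual and optimal value minus dual, to decrease.

    The decrease is proportional to the squared dual gradient, and to conclude
    from it one needs that a small dual gradient means a small distance to the
    solution [ystar]. This is the global error bound [dual_error_bound]. The
    minimizer of the Lagrangian solves the lower-level problem with [b] shifted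
    by the residual, so the bound amounts to the Lipschitz dependence of the
    minimizer over [A y <= b] on [b] ([argmin_rhs_lipschitz]), uniformly in [x].
    To prove it, shift [b] gradually: between parameters at which the minimizers
    lie on a common face the bound is linear algebra ([face_lipschitz]), there
    are finitely many faces, and lying on a given face is a closed condition.

    For fixed [x] the merit function decreases by a multiple of its residual
    ([merit_decrease]), so order [eps^-2] iterations bring the residual below a
    small multiple of [eps] ([fixed_phase]). Then every constraint inactive at
    the solution is recognized as inactive, because its gap is at least [eps],
    and the rows that remain are linearly independent, so the multiplier is
    determined up to order [eps] ([block_accuracy]). This gives (a).

    For (b), the difference [Psi] of the optimal values of the two problems is
    [delta * Phi_delta], and by the envelope theorem it is smooth. The
    [x]-step is a gradient step for [Psi] whose error is bounded by the residuals,
    so that [Psi] plus the two merit functions decreases by a multiple of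
    [|grad Psi|^2] ([potential_decrease]). After (a) this potential exceeds its
    infimum by order [delta] only, whereas as long as no iterate is
    [eps]-stationary each step lowers it by order [delta^2 eps^2]. Hence order
    [1 / (delta eps^2)], that is [eps^-3], steps suffice ([outer_phase]). *)

(** * Euclidean geometry of column vectors *)

Section Euclid.
Context {R : realType}.
Implicit Types (m n : nat).

Lemma dotvE n (u v : 'cV[R]_n) : dotv u v = (u^T *m v) 0 0.
Proof. by rewrite mxE; apply: eq_bigr => i _; rewrite mxE. Qed.

Lemma dotvC n (u v : 'cV[R]_n) : dotv u v = dotv v u.
Proof. by apply: eq_bigr => i _; rewrite mulrC. Qed.

Lemma dotvDr n (u v w : 'cV[R]_n) : dotv u (v + w) = dotv u v + dotv u w.
Proof. by rewrite !dotvE mulmxDr mxE. Qed.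

Lemma dotvZr n (u v : 'cV[R]_n) k : dotv u (k *: v) = k * dotv u v.
Proof. by rewrite !dotvE -scalemxAr mxE. Qed.

Lemma dotvNr n (u v : 'cV[R]_n) : dotv u (- v) = - dotv u v.
Proof. by rewrite !dotvE mulmxN mxE. Qed.

Lemma dotvBr n (u v w : 'cV[R]_n) : dotv u (v - w) = dotv u v - dotv u w.
Proof. by rewrite dotvDr dotvNr. Qed.

Lemma dotv0r n (u : 'cV[R]_n) : dotv u 0 = 0.
Proof. by rewrite dotvE mulmx0 mxE. Qed.

Lemma dotvDl n (u v w : 'cV[R]_n) : dotv (v + w) u = dotv v u + dotv w u.
Proof. by rewrite dotvC dotvDr !(dotvC u). Qed.

Lemma dotvZl n (u v : 'cV[R]_n) k : dotv (k *: v) u = k * dotv v u.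
Proof. by rewrite dotvC dotvZr dotvC. Qed.

Lemma dotvNl n (u v : 'cV[R]_n) : dotv (- v) u = - dotv v u.
Proof. by rewrite dotvC dotvNr dotvC. Qed.

Lemma dotvBl n (u v w : 'cV[R]_n) : dotv (v - w) u = dotv v u - dotv w u.
Proof. by rewrite dotvDl dotvNl. Qed.

Lemma dotv0l n (u : 'cV[R]_n) : dotv 0 u = 0.
Proof. by rewrite dotvC dotv0r. Qed.

Definition dotv_lin := (@dotvDl, @dotvDr, @dotvNl, @dotvNr, @dotvZl, @dotvZr,
  @dotv0l, @dotv0r).

Lemma dotv_mulmx m n (A : 'M[R]_(m, n)) (u : 'cV[R]_n) (v : 'cV[R]_m) :
  dotv (A *m u) v = dotv u (A^T *m v).
Proof. by rewrite !dotvE trmx_mul mulmxA. Qed.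

Lemma dotv_col_mx m n (u u' : 'cV[R]_m) (v v' : 'cV[R]_n) :
  dotv (col_mx u v) (col_mx u' v') = dotv u u' + dotv v v'.
Proof. by rewrite !dotvE tr_col_mx mul_row_col mxE. Qed.

Lemma dotv_ge0 n (u : 'cV[R]_n) : 0 <= dotv u u.
Proof. by apply: sumr_ge0 => i _; rewrite -expr2 sqr_ge0. Qed.

Lemma enorm_sqr n (u : 'cV[R]_n) : enorm u ^+ 2 = dotv u u.
Proof. by rewrite sqr_sqrtr ?dotv_ge0. Qed.

Lemma enorm_ge0 n (u : 'cV[R]_n) : 0 <= enorm u.
Proof. exact: sqrtr_ge0. Qed.

Lemma dotv_self n (u : 'cV[R]_n) : dotv u u = enorm u ^+ 2.
Proof. by rewrite enorm_sqr. Qed.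

Lemma enorm_le n (u : 'cV[R]_n) k : 0 <= k -> dotv u u <= k ^+ 2 -> enorm u <= k.
Proof.
by move=> k0 h; rewrite -(ler_pXn2r (n := 2)) ?nnegrE ?enorm_ge0 // enorm_sqr.
Qed.

Lemma enorm0 n : enorm (0 : 'cV[R]_n) = 0.
Proof. by rewrite /enorm dotv0l sqrtr0. Qed.

Lemma enorm_eq0 n (u : 'cV[R]_n) : enorm u = 0 -> u = 0.
Proof.
move=> u0; have /eqP : dotv u u = 0 by rewrite -enorm_sqr u0 expr0n.
rewrite /dotv psumr_eq0; last by move=> i _; rewrite -expr2 sqr_ge0.
move/allP => h; apply/matrixP => i j; rewrite ord1 mxE.
by apply/eqP; have := h i (mem_index_enum i); rewrite mulf_eq0 orbb.
Qed.

Lemma enormZ n (u : 'cV[R]_n) k : enorm (k *: u) = `|k| * enorm u.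
Proof.
by rewrite /enorm dotvZl dotvZr mulrA -expr2 sqrtrM ?sqr_ge0 // sqrtr_sqr.
Qed.

Lemma enormN n (u : 'cV[R]_n) : enorm (- u) = enorm u.
Proof. by rewrite /enorm dotvNl dotvNr opprK. Qed.

Lemma enormB n (u v : 'cV[R]_n) : enorm (u - v) = enorm (v - u).
Proof. by rewrite -enormN opprB. Qed.

Lemma cauchy_schwarz n (u v : 'cV[R]_n) : dotv u v <= enorm u * enorm v.
Proof.
have [v0|v0] := eqVneq (enorm v) 0.
  by rewrite (enorm_eq0 v0) dotv0r enorm0 mulr0.
have vp : 0 < enorm v by rewrite lt_neqAle eq_sym v0 enorm_ge0.
have [u0|u0] := eqVneq (enorm u) 0.
  by rewrite (enorm_eq0 u0) dotv0l enorm0 mul0r.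
have up : 0 < enorm u by rewrite lt_neqAle eq_sym u0 enorm_ge0.
(* expand the square of (enorm v) u - (enorm u) v *)
have := dotv_ge0 (enorm v *: u - enorm u *: v).
rewrite !dotv_lin !dotv_self (dotvC v u) => h.
rewrite -(ler_pM2l up) -(ler_pM2l vp); nra.
Qed.

Lemma cauchy_schwarzN n (u v : 'cV[R]_n) : - (enorm u * enorm v) <= dotv u v.
Proof. by rewrite lerNl -dotvNr -(enormN v) cauchy_schwarz. Qed.

Lemma enormD n (u v : 'cV[R]_n) : enorm (u + v) <= enorm u + enorm v.
Proof.
apply: enorm_le; first by rewrite addr_ge0 ?enorm_ge0.
by rewrite !dotv_lin !dotv_self (dotvC v u); have := cauchy_schwarz u v; lra.
Qed.

Lemma enormBD n (w u v : 'cV[R]_n) :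
  enorm (u - v) <= enorm (u - w) + enorm (w - v).
Proof. by have := enormD (u - w) (w - v); rewrite addrA subrK. Qed.

Lemma enorm_add_sqr n (u v : 'cV[R]_n) :
  enorm (u + v) ^+ 2 = enorm u ^+ 2 + 2 * dotv u v + enorm v ^+ 2.
Proof. by rewrite !enorm_sqr !dotv_lin (dotvC v u); lra. Qed.

Lemma enorm_add_sqr_le n (u v : 'cV[R]_n) :
  enorm (u + v) ^+ 2 <= 2 * enorm u ^+ 2 + 2 * enorm v ^+ 2.
Proof.
by have := dotv_ge0 (u - v); rewrite enorm_add_sqr !enorm_sqr !dotv_lin (dotvC v u); lra.
Qed.

Lemma young n (u v : 'cV[R]_n) k : 0 < k ->
  dotv u v <= k / 2 * enorm u ^+ 2 + (2 * k)^-1 * enorm v ^+ 2.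
Proof.
move=> k0; have := dotv_ge0 (k *: u - v); rewrite !dotv_lin !dotv_self (dotvC v u).
move=> h; rewrite -(ler_pM2l (_ : 0 < 2 * k)) ?mulr_gt0 //.
have -> : 2 * k * (k / 2 * enorm u ^+ 2 + (2 * k)^-1 * enorm v ^+ 2) =
  k ^+ 2 * enorm u ^+ 2 + enorm v ^+ 2 by field; rewrite gt_eqF.
by lra.
Qed.

Lemma enorm_col_mx m n (u : 'cV[R]_m) (v : 'cV[R]_n) :
  enorm (col_mx u v) ^+ 2 = enorm u ^+ 2 + enorm v ^+ 2.
Proof. by rewrite !enorm_sqr dotv_col_mx. Qed.

Lemma enorm_usubmx m n (w : 'cV[R]_(m + n)) : enorm (usubmx w) <= enorm w.
Proof.
apply: enorm_le; first exact: enorm_ge0.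
by rewrite -{3}(vsubmxK w) enorm_col_mx !enorm_sqr lerDl dotv_ge0.
Qed.

Lemma enorm_dsubmx m n (w : 'cV[R]_(m + n)) : enorm (dsubmx w) <= enorm w.
Proof.
apply: enorm_le; first exact: enorm_ge0.
by rewrite -{3}(vsubmxK w) enorm_col_mx !enorm_sqr lerDr dotv_ge0.
Qed.

Lemma enorm_coord n (u : 'cV[R]_n) i : `|u i 0| <= enorm u.
Proof.
rewrite -(ler_pXn2r (n := 2)) ?nnegrE ?enorm_ge0 //.
rewrite enorm_sqr real_normK ?num_real // /dotv (bigD1 i) //= -expr2 lerDl.
by apply: sumr_ge0 => j _; rewrite -expr2 sqr_ge0.
Qed.

Lemma normr_le_enorm n (u : 'cV[R]_n) : `|u| <= enorm u.
Proof.
rewrite [leLHS]/Num.norm /= mx_normrE; apply/bigmax_leP; split; first exact: enorm_ge0.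
by move=> [i j] _ /=; rewrite ord1 enorm_coord.
Qed.

Lemma enorm_le_normr n (u : 'cV[R]_n) : enorm u <= n.+1%:R * `|u|.
Proof.
apply: enorm_le; first by rewrite mulr_ge0.
apply: (@le_trans _ _ (\sum_(i < n) `|u| ^+ 2)).
  apply: ler_sum => i _; rewrite -expr2 -real_normK ?num_real //.
  rewrite ler_pXn2r ?nnegrE // [leRHS]/Num.norm /= mx_normrE.
  by apply/bigmax_geP; right; exists (i, 0).
rewrite sumr_const card_ord -[leLHS]mulr_natl exprMn ler_wpM2r ?sqr_ge0 //.
by rewrite -natrX ler_nat; apply: (leq_trans (leqnSn n)); rewrite leq_pmulr.
Qed.

Definition frobenius m n (A : 'M[R]_(m, n)) : R :=
  Num.sqrt (\sum_i \sum_j A i j ^+ 2).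

Lemma frobenius_ge0 m n (A : 'M[R]_(m, n)) : 0 <= frobenius A.
Proof. exact: sqrtr_ge0. Qed.

Lemma enorm_mulmx m n (A : 'M[R]_(m, n)) (u : 'cV[R]_n) :
  enorm (A *m u) <= frobenius A * enorm u.
Proof.
apply: enorm_le; first by rewrite mulr_ge0 ?frobenius_ge0 ?enorm_ge0.
rewrite exprMn sqr_sqrtr; last first.
  by apply: sumr_ge0 => i _; apply: sumr_ge0 => j _; rewrite sqr_ge0.
rewrite mulr_suml; apply: ler_sum => i _.
have -> : (A *m u) i 0 = dotv (row i A)^T u.
  by rewrite mxE; apply: eq_bigr => j _; rewrite !mxE.
have -> : \sum_j A i j ^+ 2 = enorm (row i A)^T ^+ 2.
  by rewrite enorm_sqr; apply: eq_bigr => j _; rewrite !mxE expr2.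
rewrite -exprMn -expr2 -[leLHS]real_normK ?num_real // ler_pXn2r ?nnegrE //.
  by rewrite ler_norml cauchy_schwarz cauchy_schwarzN.
by rewrite mulr_ge0 ?enorm_ge0.
Qed.

Lemma enorm_mulmx_le m n (A : 'M[R]_(m, n)) k (u : 'cV[R]_n) :
  frobenius A <= k -> enorm (A *m u) <= k * enorm u.
Proof.
by move=> Ak; apply: le_trans (enorm_mulmx A u) _; rewrite ler_wpM2r ?enorm_ge0.
Qed.

End Euclid.

(** * Gradients and quadratic expansions *)

Section Gradients.
Context {R : realType}.

Fact dotv_is_linear n (d : 'cV[R]_n) : linear (dotv d : 'cV[R]_n -> R).
Proof. by move=> k u v; rewrite dotvDr dotvZr. Qed.

HB.instance Definition _ n (d : 'cV[R]_n) :=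
  GRing.isLinear.Build R 'cV[R]_n R _ (dotv d) (@dotv_is_linear n d).

Lemma dotv_continuous n (d : 'cV[R]_n) : continuous (dotv d : 'cV[R]_n -> R).
Proof.
apply/linear_bounded_continuous/linear_boundedP.
exists (enorm d * n.+1%:R); split; first exact: num_real.
move=> r hr x; apply: (@le_trans _ _ (enorm d * enorm x)).
  by rewrite ler_norml cauchy_schwarz cauchy_schwarzN.
apply: (@le_trans _ _ (enorm d * n.+1%:R * `|x|)).
  by rewrite -mulrA ler_wpM2l ?enorm_ge0 ?enorm_le_normr.
by rewrite ler_wpM2r // ltW.
Qed.

(** A quadratic remainder is negligible against [q - p], so [d] represents the
    differential. All gradients below, in particular that of [Phi_delta], are
    read off such expansions. *)
Lemma quadratic_differentiable n (F : 'cV[R]_n -> R) (p d : 'cV[R]_n) M :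
  (forall q, `|F q - F p - dotv d (q - p)| <= M * enorm (q - p) ^+ 2) ->
  differentiable F p /\ 'd F p = dotv d :> ('cV[R]_n -> R).
Proof.
move=> h.
have [d1 key] : 'd F p = dotv d :> ('cV[R]_n -> R) /\
    (forall e : R, 0 < e -> \forall x \near nbhs (0 : 'cV[R]_n),
      `|F (x + p) - (F p + dotv d x)| <= e * `|x|).
  suff key : (forall e : R, 0 < e -> \forall x \near nbhs (0 : 'cV[R]_n),
      `|F (x + p) - (F p + dotv d x)| <= e * `|x|).
    split => //; apply: diff_unique; first exact: dotv_continuous.
    exact/eqaddoP.
  move=> e e0; set k : R := n.+1%:R.
  have k0 : 0 < k by rewrite ltr0n.
  have M0 : 0 < `|M| + 1 by rewrite ltr_wpDl.
  apply/nbhs_ballP; exists (e / ((`|M| + 1) * k ^+ 2)) => /=.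
    by rewrite divr_gt0 // mulr_gt0 // exprn_gt0.
  move=> x; rewrite -ball_normE /= sub0r normrN.
  rewrite ltr_pdivlMr; last by rewrite mulr_gt0 // exprn_gt0.
  move=> hx.
  have := h (x + p); rewrite addrK.
  rewrite -addrA -opprD => /le_trans; apply.
  have ex := enorm_le_normr x; have ex0 := enorm_ge0 x.
  have nx0 := normr_ge0 x.
  apply: (@le_trans _ _ ((`|M| + 1) * (k * `|x|) ^+ 2)).
    apply: (@le_trans _ _ ((`|M| + 1) * enorm x ^+ 2)).
      rewrite ler_wpM2r ?sqr_ge0 // (le_trans (ler_norm M)) //; lra.
    by rewrite ler_wpM2l ?(ltW M0) // ler_pXn2r ?nnegrE ?mulr_ge0 // ltW.
  rewrite [leLHS](_ : _ = (`|x| * ((`|M| + 1) * k ^+ 2)) * `|x|); last by ring.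
  by rewrite ler_wpM2r // ltW.
split => //; apply/diff_locallyP; rewrite d1; split.
  exact: dotv_continuous.
exact/eqaddoP.
Qed.

Lemma dotv_delta n (d : 'cV[R]_n) i : dotv d (delta_mx i 0) = d i 0.
Proof.
rewrite /dotv (bigD1 i) //= big1 ?addr0 => [|j ji].
  by rewrite mxE !eqxx mulr1.
by rewrite mxE (negPf ji) mulr0.
Qed.

Lemma grad_quadratic n (F : 'cV[R]_n -> R) (p d : 'cV[R]_n) M :
  (forall q, `|F q - F p - dotv d (q - p)| <= M * enorm (q - p) ^+ 2) ->
  grad F p = d.
Proof.
move=> /quadratic_differentiable[dF dE]; apply/matrixP => i j.
by rewrite ord1 mxE deriveE // dE dotv_delta.
Qed.

Lemma diff_grad n (F : 'cV[R]_n -> R) (p h : 'cV[R]_n) :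
  differentiable F p -> 'd F p h = dotv (grad F p) h.
Proof.
move=> dF.
have {1}-> : h = \sum_i h i 0 *: delta_mx i 0.
  rewrite {1}[h]matrix_sum_delta; apply: eq_bigr => i _.
  by rewrite big_ord1.
rewrite linear_sum; apply: eq_bigr => i _.
by rewrite linearZ /= mxE deriveE // mulrC.
Qed.

Lemma is_derive_line n (F : 'cV[R]_n -> R) (p h : 'cV[R]_n) (t : R) :
  differentiable F (p + t *: h) ->
  is_derive t 1 (fun s : R => F (p + s *: h)) (dotv (grad F (p + t *: h)) h).
Proof.
move=> dF.
have d1 : is_diff t ((cst p : R -> 'cV[R]_n) + ( *:%R ^~ h))
    ((0 : R -> 'cV[R]_n) + ( *:%R ^~ h)).
  exact: (is_diffD (is_diff_cst p t) (is_diff_scalel t h)).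
have d2 : is_diff (((cst p : R -> 'cV[R]_n) + ( *:%R ^~ h)) t) F
    ('d F (p + t *: h)) := differentiableP dF.
have d3 := is_diff_comp d1 d2.
apply: DeriveDef; first exact/diff_derivable/ex_diff.
rewrite deriveE; last exact: ex_diff.
rewrite diff_val /= diff_grad //.
by rewrite -[X in dotv _ X]/(0 + 1 *: h) add0r scale1r.
Qed.

(** The mean value theorem is applied to [F] along the segment minus the
    quadratic itself, which keeps the constant [L / 2]; with [L] instead,
    [delta f + g] could lose its strong convexity at [delta = mu / (2 lf1)]. *)
Lemma descent_lemma n (F : 'cV[R]_n -> R) L :
  (forall p, differentiable F p) ->
  (forall p q, enorm (grad F p - grad F q) <= L * enorm (p - q)) ->
  forall p q, `|F q - F p - dotv (grad F p) (q - p)| <= L / 2 * enorm (q - p) ^+ 2.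
Proof.
move=> dF LF p q; set h := q - p.
(* the two signs [s] give the two inequalities *)
have main (s : R) : s = 1 \/ s = -1 ->
    s * (F q - F p - dotv (grad F p) h) <= L / 2 * enorm h ^+ 2.
  move=> s1.
  pose phi (t : R) := s * (F (p + t *: h) - t * dotv (grad F p) h)
    - t ^+ 2 * (L / 2 * enorm h ^+ 2).
  pose dphi (t : R) := s * (dotv (grad F (p + t *: h)) h - dotv (grad F p) h)
    - t * (L * enorm h ^+ 2).
  have der (t : R) : is_derive t 1 phi (dphi t).
    have h1 := is_derive_line (dF (p + t *: h)).
    have h2 : is_derive t 1 (fun t : R => t * dotv (grad F p) h) (dotv (grad F p) h).
      have -> : (fun t : R => t * dotv (grad F p) h) =
        (dotv (grad F p) h) \*: (@id R) by apply/funext => z /=; rewrite mulrC.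
      by apply: is_derive_eq; rewrite /GRing.scale /= mulr1.
    have h3 : is_derive t 1 (fun t : R => t ^+ 2 * (L / 2 * enorm h ^+ 2))
        (t * (L * enorm h ^+ 2)).
      have -> : (fun t : R => t ^+ 2 * (L / 2 * enorm h ^+ 2)) =
        (L / 2 * enorm h ^+ 2) \*: (fun t : R => t ^+ 2) by apply/funext => z /=; rewrite mulrC.
      by apply: is_derive_eq; rewrite /GRing.scale /=; field.
    have h4 := is_deriveB h1 h2.
    have h5 := is_deriveZ s h4.
    exact: (is_deriveB h5 h3).
  have cphi : {within `[0%R, 1%R], continuous phi}.
    apply: continuous_subspaceT => t; apply: differentiable_continuous.
    by apply/derivable1_diffP; exact: (@ex_derive _ _ _ _ _ _ _ (der t)).
  have [c c01] := MVT ltr01 (fun t _ => der t) cphi.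
  rewrite subr0 mulr1.
  have {}c01 : 0 < c < 1 by move: c01; rewrite in_itv.
  have hl : dphi c <= 0.
    rewrite /dphi subr_le0 -dotvBl.
    have hc : enorm (grad F (p + c *: h) - grad F p) <= c * (L * enorm h).
      apply: le_trans (LF _ _) _; rewrite addrAC subrr add0r enormZ gtr0_norm; last lra.
      by rewrite mulrCA.
    have := cauchy_schwarz (grad F (p + c *: h) - grad F p) h.
    have := cauchy_schwarzN (grad F (p + c *: h) - grad F p) h.
    have := ler_wpM2r (enorm_ge0 h) hc.
    by case: s1 => ->; lra.
  rewrite /phi !scale1r scale0r addr0 /h [p + (q - p)]addrC subrK -/h => e.
  move: hl; rewrite -e; lra.
rewrite ler_norml; have := main 1 (or_introl erefl); have := main (-1) (or_intror erefl).
lra.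
Qed.

End Gradients.

(** * Minimizing strongly convex functions *)

(** Strong convexity (modulus [gam]) and smoothness (constant [M]) in the form
    of inequalities: the analysis uses derivatives only through them. *)
Definition quad_bounds (R : realType) n (gam M : R) (F : 'cV[R]_n -> R)
    (DF : 'cV[R]_n -> 'cV[R]_n) : Prop :=
  forall w w',
    F w + dotv (DF w) (w' - w) + gam / 2 * enorm (w' - w) ^+ 2 <= F w' /\
    F w' <= F w + dotv (DF w) (w' - w) + M / 2 * enorm (w' - w) ^+ 2.

Definition is_argmin (R : realType) T (S : set T) (F : T -> R) (w : T) : Prop :=
  S w /\ forall z, S z -> F w <= F z.

Definition segment_closed (R : realType) n (S : set 'cV[R]_n) : Prop :=
  forall w w' (t : R), 0 < t -> t <= 1 -> S w -> S w' -> S (w + t *: (w' - w)).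

Lemma addrDK (V : zmodType) (w d : V) : w + d - w = d.
Proof. by rewrite addrAC subrr add0r. Qed.

Section Minimization.
Context {R : realType} {n : nat}.
Implicit Types (S : set 'cV[R]_n) (F : 'cV[R]_n -> R).

Lemma le_of_small_perturbation (a b c : R) :
  (forall t, 0 < t -> t <= 1 -> a <= b + t * c) -> a <= b.
Proof.
move=> h; rewrite leNgt; apply/negP => ba.
have [c0|c0] := leP c 0; first by have := h 1 ltr01 (lexx 1); lra.
have d0 : 0 < (a - b) / (2 * c) by rewrite divr_gt0 ?mulr_gt0 //; lra.
have [le1|gt1] := leP ((a - b) / (2 * c)) 1.
  have := h _ d0 le1.
  have -> : (a - b) / (2 * c) * c = (a - b) / 2 by field; rewrite gt_eqF.
  lra.
have := h 1 ltr01 (lexx 1).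
by move: gt1; rewrite ltr_pdivlMr ?mulr_gt0 //; lra.
Qed.

Lemma quad_bounds_continuous gam M F DF :
  0 <= gam -> quad_bounds gam M F DF -> continuous F.
Proof.
move=> g0 FB p; apply: differentiable_continuous.
apply: (proj1 (quadratic_differentiable (d := DF p) (M := M / 2) _)).
move=> q; have [h1 h2] := FB p q; rewrite ger0_norm; first by lra.
have := mulr_ge0 g0 (sqr_ge0 (enorm (q - p))); lra.
Qed.

Lemma trmx_continuous m : continuous (@trmx R 1 m).
Proof.
move=> u A /nbhs_ballP[e /= e0 eA].
apply/nbhs_ballP; exists e => //= v [_ uv]; apply: eA; split => // i j.
by rewrite !mxE; exact: uv.
Qed.

(** The lower bound confines [F w <= F w0] to a ball, so that [F] attains its
    minimum on a compact set. *)
Lemma argmin_exists gam M F DF S : 0 < gam -> quad_bounds gam M F DF ->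
  closed S -> S !=set0 -> is_argmin S F (argmin S F).
Proof.
move=> g0 FB clS [w0 Sw0].
suff [w Sw] : exists w, is_argmin S F w.
  by apply: (@getPex _ [set y | S y /\ forall z, S z -> F y <= F z]); exists w.
(* pass to row vectors, the setting of [bounded_closed_compact] *)
have cF : continuous (F \o trmx : 'rV[R]_n -> R).
  move=> r; apply: continuous_comp; first exact: trmx_continuous.
  exact: (quad_bounds_continuous (ltW g0) FB).
pose B := [set r : 'rV[R]_n | S r^T] `&` [set r : 'rV[R]_n | F r^T <= F w0].
have clB : closed B.
  apply: closedI.
    apply: (closed_comp (f := trmx)) => //.
    by move=> r _; exact: trmx_continuous.
  apply: (@closed_comp _ _ (F \o trmx) [set x | x <= F w0]); last exact: closed_le.
  by move=> r _; exact: cF.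
have bB : bounded_set B.
  exists (enorm w0 + 2 * enorm (DF w0) / gam); split; first exact: num_real.
  move=> k hk r [_ /= Fr]; apply: le_trans (ltW hk).
  have -> : `|r| = `|r^T|.
    apply/eqP; rewrite eq_le; apply/andP.
    rewrite ![`|_|]/Num.norm /= !mx_normrE; split.
      apply/bigmax_leP; split; first exact: bigmax_ge_id.
      move=> [i j] _ /=; apply/bigmax_geP; right; exists (j, i) => //=.
      by rewrite mxE.
    apply/bigmax_leP; split; first exact: bigmax_ge_id.
    move=> [i j] _ /=; apply/bigmax_geP; right; exists (j, i) => //=.
    by rewrite mxE.
  apply: le_trans (normr_le_enorm _) _.
  have h1 : enorm r^T <= enorm w0 + enorm (r^T - w0).
    by have := enormD w0 (r^T - w0); rewrite addrC subrK.
  apply: le_trans h1 _; rewrite lerD2l ler_pdivlMr //.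
  have [h2 _] := FB w0 r^T.
  have h3 := cauchy_schwarzN (DF w0) (r^T - w0).
  have [->|ne0] := eqVneq (enorm (r^T - w0)) 0.
    by rewrite mul0r mulr_ge0 ?enorm_ge0.
  have ep : 0 < enorm (r^T - w0) by rewrite lt_neqAle eq_sym ne0 enorm_ge0.
  rewrite -(ler_pM2l ep).
  nra.
have B0 : B !=set0 by exists w0^T; split => /=; rewrite trmxK.
have [|r rB rmin] := EVT_min_rV B0 (bounded_closed_compact bB clB) (f := F \o trmx).
  exact: continuous_subspaceT.
move: rB; rewrite inE => -[/= Sr Fr].
exists r^T; split => // z Sz.
have [Fz|/ltW Fz] := leP (F z) (F w0); last exact: le_trans Fr _.
have := rmin z^T; rewrite /= trmxK; apply; rewrite inE; split => /=; by rewrite trmxK.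
Qed.

Lemma argmin_variational gam M F DF S w : quad_bounds gam M F DF ->
  segment_closed S -> is_argmin S F w ->
  forall z, S z -> 0 <= dotv (DF w) (z - w).
Proof.
move=> FB cS [Sw wmin] z Sz.
apply: (@le_of_small_perturbation _ _ (M / 2 * enorm (z - w) ^+ 2)) => t t0 t1.
have := wmin _ (cS _ _ _ t0 t1 Sw Sz); have [_] := FB w (w + t *: (z - w)).
rewrite addrDK dotvZr enormZ gtr0_norm // => h1 h2.
rewrite -(pmulr_rge0 _ t0); nra.
Qed.

Lemma argmin_growth gam M F DF S w : quad_bounds gam M F DF ->
  segment_closed S -> is_argmin S F w ->
  forall z, S z -> F w + gam / 2 * enorm (z - w) ^+ 2 <= F z.
Proof.
move=> FB cS wmin z Sz; have := argmin_variational FB cS wmin Sz.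
by have [h _] := FB w z; lra.
Qed.

Lemma argmin_unique gam M F DF S w : 0 < gam -> quad_bounds gam M F DF ->
  segment_closed S -> is_argmin S F w -> argmin S F = w.
Proof.
move=> g0 FB cS wmin.
have [Sa amin] : is_argmin S F (argmin S F).
  by apply: (@getPex _ [set y | S y /\ forall z, S z -> F y <= F z]); exists w.
have h := argmin_growth FB cS wmin Sa; have := amin _ wmin.1 => h2.
apply/eqP; rewrite -subr_eq0; apply/eqP/enorm_eq0/eqP.
have := enorm_ge0 (argmin S F - w); rewrite le_eqVlt eq_sym => /orP[//|ep].
exfalso; have : 0 < gam * enorm (argmin S F - w) ^+ 2 by rewrite mulr_gt0 ?exprn_gt0.
lra.
Qed.

(** Strong monotonicity of [DF1] around [w1], plus the variational inequality
    of [w2]. This bounds the drift of a minimizer under a change of objective. *)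
Lemma argmin_sensitivity gam M F1 DF1 F2 DF2 S w1 w2 :
  quad_bounds gam M F1 DF1 -> quad_bounds gam M F2 DF2 ->
  segment_closed S -> is_argmin S F1 w1 -> is_argmin S F2 w2 ->
  gam * enorm (w2 - w1) ^+ 2 <= dotv (DF1 w2 - DF2 w2) (w2 - w1).
Proof.
move=> FB1 FB2 cS m1 m2.
have h1 := argmin_growth FB1 cS m1 m2.1.
have h2 := argmin_variational FB2 cS m2 m1.1.
have [h3 _] := FB1 w2 w1.
move: h2 h3; rewrite -(opprB w2 w1) !dotvNr enormN dotvBl; lra.
Qed.

Lemma sqdist_quad_bounds p :
  quad_bounds 2 2 (fun q : 'cV[R]_n => enorm (q - p) ^+ 2) (fun q => 2 *: (q - p)).
Proof.
move=> q q'.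
have -> : enorm (q' - p) ^+ 2 = enorm (q - p) ^+ 2 + dotv (2 *: (q - p)) (q' - q)
     + 2 / 2 * enorm (q' - q) ^+ 2.
  have -> : q' - p = (q - p) + (q' - q) by rewrite [RHS]addrC addrA subrK.
  by rewrite !enorm_sqr !dotv_lin (dotvC q' q) !(dotvC _ p); field.
by [].
Qed.

(** The projected step minimizes over [S] the quadratic model of [F] at [w] with
    curvature [1 / eta]. Its value is compared with that of the point at fraction
    [gam * eta] of the way to [wbar], where the quadratic term cancels against
    the strong convexity of [F]. *)
Lemma projected_gradient_contraction gam M F DF S w wbar eta :
  0 < gam -> quad_bounds gam M F DF -> closed S -> segment_closed S ->
  is_argmin S F wbar -> S w -> 0 < eta -> gam * eta <= 1 -> M * eta <= 1 ->
  let w' := eproj S (w - eta *: DF w) in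
  S w' /\ F w' - F wbar <= (1 - gam * eta) * (F w - F wbar).
Proof.
move=> g0 FB clS cS bmin Sw e0 ge1 Me1 w'.
set p := w - eta *: DF w in w' *.
pose Q (q : 'cV[R]_n) := enorm (q - p) ^+ 2.
have QB : quad_bounds 2 2 Q (fun q => 2 *: (q - p)) := sqdist_quad_bounds p.
have [Sw' w'min] : is_argmin S (fun q => enorm (q - p)) w'.
  have := argmin_exists (ltr0Sn R 1) QB clS (ex_intro _ w Sw).
  move=> [a1 a2]; apply: (@getPex _ [set y | S y /\ forall z, S z -> enorm (y - p) <= enorm (z - p)]).
  exists (argmin S Q); split => // z Sz.
  by rewrite -(ler_pXn2r (n := 2)) ?nnegrE ?enorm_ge0 //; exact: a2.
split => //.
have [Sb bm] := bmin.
set th := gam * eta; have th0 : 0 < th by rewrite mulr_gt0.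
have Sv := cS _ _ _ th0 ge1 Sw Sb.
have := w'min _ Sv; rewrite -(ler_pXn2r (n := 2)) ?nnegrE ?enorm_ge0 //.
have -> : w' - p = (w' - w) + eta *: DF w by rewrite /p opprD opprK addrA.
have -> : w + th *: (wbar - w) - p = th *: (wbar - w) + eta *: DF w.
  by rewrite /p opprD opprK addrA [w + _]addrC addrK.
have [_ up] := FB w w'; have [lo _] := FB w wbar.
move: (w' - w) (wbar - w) up lo => d1 d2.
rewrite !enorm_sqr !dotv_lin !(dotvC _ (DF w)).
set a := dotv (DF w) d1; set b := dotv (DF w) d2; set s1 := dotv d1 d1.
set s2 := dotv d2 d2 => up lo cmp.
have s10 : 0 <= s1 := dotv_ge0 d1.
have {}up : 2 * eta * (F w' - F w) <= 2 * eta * a + s1.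
  have e1 := ler_wpM2l (ltW e0) up.
  have e2 := ler_wpM2r s10 Me1.
  by lra.
have {}lo : 2 * eta * th * b <= 2 * eta * th * (F wbar - F w) - th ^+ 2 * s2.
  have e1 := ler_wpM2l (ltW (mulr_gt0 e0 th0)) lo.
  rewrite /th in e1 *; lra.
rewrite -(ler_pM2l (mulr_gt0 (ltr0Sn R 1) e0)); lra.
Qed.
End Minimization.

(** * Farkas' lemma and faces of polyhedra *)

Section Polyhedra.
Context {R : realType}.

Lemma finite_min_pos (I : finType) (P : I -> R -> Prop) :
  (forall i, exists2 e, 0 < e & forall t, 0 <= t -> t <= e -> P i t) ->
  exists2 e, 0 < e & forall i t, 0 <= t -> t <= e -> P i t.
Proof.
move=> h; have /choice[e he] : forall i, exists e, 0 < e /\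
    forall t, 0 <= t -> t <= e -> P i t.
  by move=> i; have [e] := h i; exists e.
exists (\big[Order.min/1]_i e i).
  by apply/bigmin_gtP; split=> [|i _]; [exact: ltr01|have [] := he i].
move=> i t t0 te; have [_] := he i; apply => //.
by apply: le_trans te _; apply: bigmin_le_cond.
Qed.

(** Farkas' lemma, by Bartl's induction on the number of generators: if the
    first [m] of them do not suffice, some [e] separates them from [c], and
    projecting along the last generator kills [e] and reduces to [m]. *)
Lemma farkas n m (a : nat -> 'cV[R]_n) (c : 'cV[R]_n) :
  (forall d, (forall i, (i < m)%N -> dotv (a i) d <= 0) -> dotv c d <= 0) ->
  exists l : nat -> R, (forall i, 0 <= l i) /\ c = \sum_(i < m) l i *: a i.
Proof.
elim: m a c => [|m IH] a c h.
  exists (fun=> 0); split => //; rewrite big_ord0; apply: enorm_eq0.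
  have := h c (fun i H => ltac:(by [])); rewrite dotv_self => h1.
  by apply/eqP; rewrite -sqrf_eq0 eq_le h1 sqr_ge0.
have [hm|/existsNP[e /not_implyP[ae ce]]] := pselect
    (forall d, (forall i, (i < m)%N -> dotv (a i) d <= 0) -> dotv c d <= 0).
  have [l [l0 lc]] := IH a c hm.
  exists (fun i => if i == m then 0 else l i); split; first by move=> i; case: ifP.
  rewrite big_ord_recr /= eqxx scale0r addr0 lc.
  by apply: eq_bigr => i _; rewrite ltn_eqF.
have {}ce : 0 < dotv c e by rewrite ltNge; apply/negP.
have ame : 0 < dotv (a m) e.
  rewrite ltNge; apply/negP => ame; suff : dotv c e <= 0 by lra.
  by apply: h => i; rewrite ltnS leq_eqVlt => /orP[/eqP->//|]; exact: ae.
(* project along a m onto the hyperplane orthogonal to e *)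
pose pr (u : 'cV[R]_n) := u - (dotv u e / dotv (a m) e) *: a m.
have [d hd|l [l0 lc]] := IH (fun i => pr (a i)) (pr c).
  pose d' := d - (dotv (a m) d / dotv (a m) e) *: e.
  have prE u : dotv (pr u) d = dotv u d'.
    by rewrite /pr /d' !dotv_lin; field; rewrite gt_eqF.
  rewrite prE; apply: h => i; rewrite ltnS leq_eqVlt => /orP[/eqP->|im].
    by rewrite /d' !dotv_lin divfK ?gt_eqF // subrr.
  by rewrite -prE; exact: hd.
pose lm := dotv c e / dotv (a m) e - \sum_(i < m) l i * (dotv (a i) e / dotv (a m) e).
have lm0 : 0 <= lm.
  rewrite subr_ge0; apply: (@le_trans _ _ 0); last by rewrite divr_ge0 // ltW.
  apply: sumr_le0 => i _; rewrite mulr_ge0_le0 // mulr_le0_ge0 ?ae //.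
  by rewrite invr_ge0 ltW.
exists (fun i => if i == m then lm else l i); split.
  by move=> i; case: ifP.
rewrite big_ord_recr /= eqxx.
have -> : c = pr c + (dotv c e / dotv (a m) e) *: a m by rewrite subrK.
rewrite {1}lc /lm scalerBl scaler_suml.
have -> : \sum_(i < m) l i *: pr (a i) = \sum_(i < m) l i *: a i -
    \sum_(i < m) (l i * (dotv (a i) e / dotv (a m) e)) *: a m.
  by rewrite -sumrB; apply: eq_bigr => i _; rewrite scalerBr scalerA.
rewrite -addrA; congr (_ + _); last by rewrite addrC.
by apply: eq_bigr => i _; rewrite ltn_eqF.
Qed.

Context {m n : nat} (A : 'M[R]_(m, n)).
Implicit Types (b r : 'cV[R]_m) (y z d : 'cV[R]_n) (I : {set 'I_m}).

Lemma mulmx_coord y i : (A *m y) i 0 = dotv (row i A)^T y.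
Proof. by rewrite mxE; apply: eq_bigr => j _; rewrite !mxE. Qed.

Lemma slackE b y i : slack A b y i 0 = (A *m y) i 0 - b i 0.
Proof. by rewrite !mxE. Qed.

Lemma feasible_closed b : closed (feasible A b).
Proof.
have -> : feasible A b = \bigcap_(i in [set: 'I_m]) [set y | (A *m y) i 0 <= b i 0].
  apply/seteqP; split => y /= h; first by move=> i _ /=; have := h i; rewrite slackE subr_le0.
  by move=> i; rewrite slackE subr_le0; exact: h.
apply: closed_bigI => i _.
apply: (@closed_comp _ _ (fun y => (A *m y) i 0) [set x | x <= b i 0]); last exact: closed_le.
move=> y _; under eq_fun do rewrite mulmx_coord; exact: dotv_continuous.
Qed.

Lemma feasible_segment b : segment_closed (feasible A b).
Proof.
move=> y z t t0 t1 hy hz i; have := hy i; have := hz i.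
rewrite !slackE mulmxDr -scalemxAr mulmxBr !mxE; nra.
Qed.

Section Face.
Variables (mu M L : R) (G : 'cV[R]_n -> R) (D : 'cV[R]_n -> 'cV[R]_n).
Hypothesis mu0 : 0 < mu.
Hypothesis GB : quad_bounds mu M G D.
Hypothesis DL : forall y z, enorm (D y - D z) <= L * enorm (y - z).

Lemma gradient_monotone y z : mu * enorm (y - z) ^+ 2 <= dotv (D y - D z) (y - z).
Proof.
have [h1 _] := GB y z; have [h2 _] := GB z y; move: h1 h2.
by rewrite -(opprB y z) !dotvNr enormN dotvBl; lra.
Qed.

(** A direction that enters every active half-space stays feasible for a short
    step, since the inactive constraints have room. *)
Lemma argmin_polar b y : is_argmin (feasible A b) G y ->
  forall d, (forall i, i \in active A b y -> (A *m d) i 0 <= 0) -> 0 <= dotv (D y) d.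
Proof.
move=> ymin d hd.
have [e e0 he] : exists2 e, 0 < e & forall i t, 0 <= t -> t <= e ->
    slack A b y i 0 + t * (A *m d) i 0 <= 0.
  apply: finite_min_pos => i.
  have := ymin.1 i; rewrite le_eqVlt => /orP[si|si].
    exists 1 => // t t0 _; rewrite (eqP si) add0r mulr_ge0_le0 //.
    by apply: hd; rewrite inE.
  have k0 : 0 < `|(A *m d) i 0| + 1 by rewrite ltr_wpDl.
  exists (- slack A b y i 0 / (`|(A *m d) i 0| + 1)).
    by rewrite divr_gt0 // oppr_gt0.
  move=> t t0; rewrite ler_pdivlMr // => ht.
  have := ler_wpM2l t0 (ler_norm ((A *m d) i 0)); lra.
have Yd : feasible A b (y + e *: d).
  by move=> i; rewrite slackE mulmxDr -scalemxAr !mxE; have := he i e (ltW e0) (lexx e);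
     rewrite slackE !mxE; lra.
have := argmin_variational GB (@feasible_segment b) ymin Yd.
by rewrite addrDK dotvZr pmulr_rge0.
Qed.

(** Farkas' lemma applied to the polar condition; complementarity holds because
    only the active rows serve as generators. *)
Lemma multiplier_exists b y : is_argmin (feasible A b) G y ->
  exists u : 'cV[R]_m, [/\ forall i, 0 <= u i 0, D y + A^T *m u = 0
    & forall i, u i 0 * slack A b y i 0 = 0].
Proof.
move=> ymin.
pose a (k : nat) : 'cV[R]_n := if insub k is Some i then
  (if i \in active A b y then (row i A)^T else 0) else 0.
have aE (i : 'I_m) : a i = if i \in active A b y then (row i A)^T else 0.
  by rewrite /a valK.
have [d hd|l [l0 lD]] := @farkas n m a (- D y).
  rewrite dotvNl oppr_le0; apply: (argmin_polar ymin) => i iI.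
  by have := hd i (ltn_ord i); rewrite aE iI mulmx_coord.
exists (\col_i if i \in active A b y then l i else 0); split.
- by move=> i; rewrite mxE; case: ifP.
- apply/eqP; rewrite addrC addr_eq0 lD; apply/eqP/matrixP => j k; rewrite ord1 mxE.
  rewrite summxE; apply: eq_bigr => i _; rewrite !mxE aE.
  by case: ifP => _; rewrite !mxE ?mulr0 // mulrC.
- by move=> i; rewrite mxE inE; case: ifP => [/eqP->|]; rewrite ?mulr0 ?mul0r.
Qed.

(** Rows outside [I] are zeroed, so that all faces share one matrix type. *)
Definition mask_rows k I (B : 'M[R]_(m, k)) : 'M[R]_(m, k) :=
  \matrix_(i, j) (if i \in I then B i j else 0).

Definition face_const I : R := frobenius (pinvmx (mask_rows I A)^T)^T.

(** The sum dominates the constant of each of the finitely many faces. *)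
Definition rhs_const : R := \sum_I face_const I.

Lemma rhs_const_ge I : face_const I <= rhs_const.
Proof.
by rewrite /rhs_const (bigD1 I) //= lerDl sumr_ge0 // => J _; exact: frobenius_ge0.
Qed.

Lemma rhs_const_ge0 : 0 <= rhs_const.
Proof. by apply: sumr_ge0 => J _; exact: frobenius_ge0. Qed.

Lemma mask_mulmx I y i : (mask_rows I A *m y) i 0 = if i \in I then (A *m y) i 0 else 0.
Proof.
rewrite !mxE; case: ifP => iI; first by apply: eq_bigr => j _; rewrite mxE iI.
by rewrite big1 // => j _; rewrite mxE iI mul0r.
Qed.

Lemma face_solution I r z : (forall i, i \in I -> (A *m z) i 0 = r i 0) ->
  exists q, (forall i, i \in I -> (A *m q) i 0 = r i 0) /\
    enorm q <= rhs_const * enorm r.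
Proof.
move=> zr; exists ((pinvmx (mask_rows I A)^T)^T *m mask_rows I r); split.
  move=> i iI.
  have sub : ((mask_rows I r)^T <= (mask_rows I A)^T)%MS.
    apply/submxP; exists z^T; rewrite -trmx_mul; congr trmx.
    by apply/matrixP => k j; rewrite ord1 mask_mulmx mxE; case: ifP => // /zr.
  have e : mask_rows I A *m ((pinvmx (mask_rows I A)^T)^T *m mask_rows I r)
      = mask_rows I r.
    by apply: trmx_inj; rewrite trmx_mul trmx_mul trmxK mulmxKpV.
  by have := mask_mulmx I ((pinvmx (mask_rows I A)^T)^T *m mask_rows I r) i;
     rewrite iI e => <-; rewrite mxE iI.
apply: le_trans (enorm_mulmx _ _) _.
apply: ler_pM; rewrite ?frobenius_ge0 ?enorm_ge0 //; first exact: rhs_const_ge.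
apply: enorm_le; first exact: enorm_ge0.
rewrite enorm_sqr; apply: ler_sum => i _; rewrite mxE.
by case: ifP => // _; rewrite mul0r -expr2 sqr_ge0.
Qed.

(** Modulo directions of the face, [y - z] equals a solution [q] of the
    equations [A_I q = k r_I], of size at most [rhs_const * |k r|]. The
    gradients annihilate those directions, so that strong monotonicity bounds
    [y - z] by [q]. *)
Lemma face_lipschitz I r k y z :
  (forall i, i \in I -> (A *m (y - z)) i 0 = k * r i 0) ->
  (forall d, (forall i, i \in I -> (A *m d) i 0 = 0) -> dotv (D y) d = 0) ->
  (forall d, (forall i, i \in I -> (A *m d) i 0 = 0) -> dotv (D z) d = 0) ->
  mu * enorm (y - z) <= `|L| * rhs_const * (`|k| * enorm r).
Proof.
move=> yz Dy Dz.
have [q [Aq nq]] : exists q, (forall i, i \in I -> (A *m q) i 0 = k * r i 0) /\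
    enorm q <= rhs_const * (`|k| * enorm r).
  have [|q [q1 q2]] := @face_solution I (k *: r) (y - z).
    by move=> i iI; rewrite [RHS]mxE yz.
  by exists q; rewrite -enormZ; split => // i iI; rewrite q1 // [LHS]mxE.
have Ad i : i \in I -> (A *m (y - z - q)) i 0 = 0.
  by move=> iI; rewrite mulmxBr mxE [X in _ + X]mxE yz // Aq // subrr.
have e : dotv (D y - D z) (y - z) = dotv (D y - D z) q.
  by apply/eqP; rewrite -subr_eq0 -dotvBr dotvBl (Dy _ Ad) (Dz _ Ad) subrr.
have h1 := gradient_monotone y z; rewrite e in h1.
have h2 := cauchy_schwarz (D y - D z) q.
have [->|ne0] := eqVneq (enorm (y - z)) 0.
  by rewrite mulr0 !mulr_ge0 ?rhs_const_ge0 ?enorm_ge0.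
have ep : 0 < enorm (y - z) by rewrite lt_neqAle eq_sym ne0 enorm_ge0.
have h3 : enorm (D y - D z) <= `|L| * enorm (y - z).
  by apply: le_trans (DL y z) _; rewrite ler_wpM2r ?enorm_ge0 ?ler_norm.
have h4 := ler_pM (enorm_ge0 _) (enorm_ge0 _) h3 nq.
by rewrite -(ler_pM2r ep); lra.
Qed.

End Face.
End Polyhedra.

(** * Lipschitz dependence of minimizers on the right-hand side *)

(** The supremum of the parameters up to which the bound holds is attained, and
    the local bound excludes that it is less than [1]. *)
Lemma lipschitz_of_local (R : realType) n (phi : R -> 'cV[R]_n) (k : R) :
  (forall s, 0 <= s <= 1 -> exists2 e, 0 < e & forall t, 0 <= t <= 1 ->
     `|t - s| <= e -> enorm (phi t - phi s) <= k * `|t - s|) ->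
  enorm (phi 1 - phi 0) <= k.
Proof.
move=> loc.
pose E := [set s | 0 <= s <= 1 /\ enorm (phi s - phi 0) <= k * s].
have E0 : E 0 by split; rewrite ?lexx ?ler01 // subrr enorm0 mulr0.
have hE : has_sup E by split; [exists 0|exists 1 => s [/andP[_ ->]]].
have s0 : 0 <= sup E by apply: ub_le_sup => //; case: hE.
have s1 : sup E <= 1 by apply: ge_sup; [exists 0|move=> s [/andP[_ ->]]].
have s01 : 0 <= sup E <= 1 by rewrite s0.
have [e e0 he] := loc _ s01.
have Es : E (sup E).
  split => //.
  have [t [t01 Et] st] := sup_adherent e0 hE.
  have ts : t <= sup E by apply: ub_le_sup; [case: hE|].
  have := he t t01; rewrite ler0_norm ?subr_le0 //.
  have e1 := enormBD (phi t) (phi (sup E)) (phi 0).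
  rewrite (enormB (phi (sup E)) (phi t)) in e1.
  have h : - (t - sup E) <= e by lra.
  by move=> /(_ h); lra.
have [lt1|ge1] := ltP (sup E) 1; last first.
  have e1 : sup E = 1 by apply/eqP; rewrite eq_le s1 ge1.
  by case: Es => _; rewrite e1 mulr1.
pose t := Order.min 1 (sup E + e).
have t1 : t <= 1 by rewrite /t ge_min lexx.
have te : t <= sup E + e by rewrite /t ge_min lexx orbT.
have st : sup E < t by rewrite /t lt_min lt1 ltrDl.
have t01 : 0 <= t <= 1 by rewrite t1 (le_trans s0 (ltW st)).
have := he t t01; rewrite ger0_norm ?subr_ge0 ?(ltW st) //.
have h : t - sup E <= e by lra.
move=> /(_ h) h2.
have Et : E t.
  split => //; have e1 := enormBD (phi (sup E)) (phi t) (phi 0).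
  by have := Es.2; lra.
by have := ub_le_sup hE.2 Et; rewrite leNgt st.
Qed.

Section Homotopy.
Context {R : realType} {m n : nat} (A : 'M[R]_(m, n)).
Variables (mu M L : R) (G : 'cV[R]_n -> R) (D : 'cV[R]_n -> 'cV[R]_n).
Hypothesis mu0 : 0 < mu.
Hypothesis GB : quad_bounds mu M G D.
Hypothesis DL : forall y z, enorm (D y - D z) <= L * enorm (y - z).
Variables (b r : 'cV[R]_m) (y0 y1 : 'cV[R]_n).
Hypothesis y0min : is_argmin (feasible A b) G y0.
Hypothesis y1min : is_argmin (feasible A (b + r)) G y1.

Let Y (s : R) : 'cV[R]_n := argmin (feasible A (b + s *: r)) G.

Lemma homotopy_feasible s t k y z : feasible A (b + s *: r) y ->
  feasible A (b + t *: r) z -> 0 <= k <= 1 ->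
  feasible A (b + (s + k * (t - s)) *: r) (y + k *: (z - y)).
Proof.
move=> hy hz k01 i; have := hy i; have := hz i.
rewrite !slackE mulmxDr -scalemxAr mulmxBr !mxE; nra.
Qed.

Lemma homotopy_argmin s : 0 <= s <= 1 -> is_argmin (feasible A (b + s *: r)) G (Y s).
Proof.
move=> s01; apply: (argmin_exists mu0 GB); first exact: feasible_closed.
have h0 : feasible A (b + 0 *: r) y0 by rewrite scale0r addr0; case: y0min.
have h1 : feasible A (b + 1 *: r) y1 by rewrite scale1r; case: y1min.
exists (y0 + s *: (y1 - y0)).
by have := homotopy_feasible h0 h1 s01; rewrite add0r subr0 mulr1.
Qed.

(** The multiplier at [s] bounds the value at [t] from below, and a feasible
    point between [Y s] and an endpoint bounds it from above; by strong
    convexity the difference of values dominates a squared distance. *)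
Lemma homotopy_holder s : 0 <= s <= 1 -> exists2 C, 0 <= C &
  forall t, 0 <= t <= 1 -> enorm (Y t - Y s) ^+ 2 <= C * `|t - s|.
Proof.
move=> s01; have smin := homotopy_argmin s01.
have [u [u0 Du us]] := multiplier_exists GB smin.
(* [e] will be 0 or 1, the end of the homotopy that [t] lies towards *)
pose cost e := enorm (D (Y s)) * enorm (Y e - Y s) + `|M| / 2 * enorm (Y e - Y s) ^+ 2.
have cost0 e : 0 <= cost e by rewrite addr_ge0 ?mulr_ge0 ?enorm_ge0 ?sqr_ge0 ?divr_ge0.
have up e k t : 0 <= e <= 1 -> 0 <= k <= 1 -> t = s + k * (e - s) ->
    0 <= t <= 1 -> G (Y t) <= G (Y s) + k * cost e.
  move=> e01 k01 te t01.
  have fe := homotopy_feasible smin.1 (homotopy_argmin e01).1 k01.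
  rewrite -te in fe; have := (homotopy_argmin t01).2 _ fe => h1.
  have [_] := GB (Y s) (Y s + k *: (Y e - Y s)); rewrite addrDK dotvZr enormZ.
  have /andP[k0 k1] := k01; rewrite ger0_norm // => h2.
  have h3 := cauchy_schwarz (D (Y s)) (Y e - Y s).
  have h4 : M / 2 * (k * enorm (Y e - Y s)) ^+ 2 <= k * (`|M| / 2 * enorm (Y e - Y s) ^+ 2).
    rewrite exprMn mulrCA; set N := enorm _ ^+ 2.
    have N0 : 0 <= N by rewrite sqr_ge0.
    have e1 : k ^+ 2 <= k by rewrite expr2 -[leRHS]mulr1 ler_wpM2l.
    apply: (@le_trans _ _ (k ^+ 2 * (`|M| / 2 * N))).
      rewrite ler_wpM2l ?sqr_ge0 // ler_wpM2r // ler_wpM2r ?invr_ge0 //; exact: ler_norm.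
    by rewrite ler_wpM2r // mulr_ge0 // divr_ge0.
  rewrite /cost mulrDr; have := ler_wpM2l k0 h3; lra.
pose C1 := (1 - s)^-1 * cost 1 + s^-1 * cost 0.
have /andP[sge0 sle1] := s01.
have C10 : 0 <= C1 by rewrite addr_ge0 ?mulr_ge0 ?invr_ge0 ?subr_ge0.
have upper t : 0 <= t <= 1 -> G (Y t) <= G (Y s) + `|t - s| * C1.
  move=> t01; have /andP[t0 t1] := t01.
  have i0 : 0 <= s^-1 by rewrite invr_ge0.
  have i1 : 0 <= (1 - s)^-1 by rewrite invr_ge0 subr_ge0.
  have [ts|st|->] := ltgtP t s; last by rewrite subrr normr0 mul0r addr0.
  - rewrite ltr0_norm ?subr_lt0 // opprB.
    have s'0 : 0 < s by lra.
    have k01 : 0 <= (s - t) / s <= 1.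
      by rewrite ler_pdivrMr // mul1r divr_ge0 ?subr_ge0 ?(ltW ts) //=; lra.
    have e01 : 0 <= (0 : R) <= 1 by rewrite lexx ler01.
    have e1 : t = s + (s - t) / s * (0 - s) by field; rewrite gt_eqF.
    have h := up _ _ _ e01 k01 e1 t01; apply: le_trans h _.
    rewrite lerD2l -mulrA ler_wpM2l ?subr_ge0 ?(ltW ts) // /C1 lerDr.
    by rewrite mulr_ge0.
  - rewrite gtr0_norm ?subr_gt0 //.
    have s'0 : 0 < 1 - s by lra.
    have k01 : 0 <= (t - s) / (1 - s) <= 1.
      by rewrite ler_pdivrMr // mul1r divr_ge0 ?subr_ge0 ?(ltW st) //=; lra.
    have e01 : 0 <= (1 : R) <= 1 by rewrite lexx ler01.
    have e1 : t = s + (t - s) / (1 - s) * (1 - s) by rewrite divfK ?gt_eqF // addrC subrK.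
    have h := up _ _ _ e01 k01 e1 t01; apply: le_trans h _.
    rewrite lerD2l -mulrA ler_wpM2l ?subr_ge0 ?(ltW st) // /C1 lerDl.
    by rewrite mulr_ge0.
exists (2 / mu * (C1 + enorm u * enorm r)).
  apply: mulr_ge0; first by rewrite divr_ge0 // ltW.
  by rewrite addr_ge0 // mulr_ge0 ?enorm_ge0.
move=> t t01; have h1 := upper t t01.
have [h2 _] := GB (Y s) (Y t).
have h3 : - (`|t - s| * (enorm u * enorm r)) <= dotv (D (Y s)) (Y t - Y s).
  have -> : D (Y s) = - (A^T *m u) by apply/eqP; rewrite -addr_eq0 Du.
  rewrite dotvNl lerN2 dotvC -dotv_mulmx.
  have -> : dotv (A *m (Y t - Y s)) u =
      dotv (slack A (b + t *: r) (Y t)) u + (t - s) * dotv r u.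
    have -> : A *m (Y t - Y s) = slack A (b + t *: r) (Y t) -
        slack A (b + s *: r) (Y s) + (t - s) *: r.
      by apply/matrixP => i j; rewrite mulmxBr !mxE; ring.
    rewrite dotvDl dotvBl dotvZl.
    have -> : dotv (slack A (b + s *: r) (Y s)) u = 0.
      by rewrite dotvC /dotv big1 // => i _; exact: us.
    by rewrite subr0.
  have e1 : dotv (slack A (b + t *: r) (Y t)) u <= 0.
    apply: sumr_le0 => i _; rewrite mulr_le0_ge0 //; exact: (homotopy_argmin t01).1.
  have e2 : (t - s) * dotv r u <= `|t - s| * (enorm u * enorm r).
    apply: le_trans (ler_norm _) _; rewrite normrM ler_wpM2l //.
    by rewrite ler_norml mulrC cauchy_schwarz cauchy_schwarzN.
  by lra.
rewrite -(ler_pM2l (_ : 0 < mu / 2)) ?divr_gt0 //.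
have -> : mu / 2 * (2 / mu * (C1 + enorm u * enorm r) * `|t - s|) =
  (C1 + enorm u * enorm r) * `|t - s| by field; rewrite gt_eqF.
lra.
Qed.

Lemma homotopy_continuous s d : 0 <= s <= 1 -> 0 < d -> exists2 e, 0 < e &
  forall t, 0 <= t <= 1 -> `|t - s| <= e -> enorm (Y t - Y s) <= d /\ `|t - s| <= d.
Proof.
move=> s01 d0; have [C C0 hC] := homotopy_holder s01.
exists (Order.min d (d ^+ 2 / (C + 1))).
  by rewrite lt_min d0 divr_gt0 ?exprn_gt0 // ltr_wpDl.
move=> t t01; rewrite le_min ler_pdivlMr ?ltr_wpDl // => /andP[h1 h2]; split => //.
apply: enorm_le; first exact: ltW.
rewrite dotv_self; have := hC t t01; have := normr_ge0 (t - s); lra.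
Qed.

(** The parameters whose minimizer satisfies the equalities of the face [I]
    and is stationary along it: a closed condition, unlike having [I] as the
    active set. *)
Let onface (I : {set 'I_m}) s := (forall i, i \in I -> (A *m Y s) i 0 = (b + s *: r) i 0) /\
  forall d, (forall i, i \in I -> (A *m d) i 0 = 0) -> dotv (D (Y s)) d = 0.

Lemma onface_active s : 0 <= s <= 1 -> onface (active A (b + s *: r) (Y s)) s.
Proof.
move=> s01; have smin := homotopy_argmin s01; split.
  by move=> i; rewrite inE slackE subr_eq0 => /eqP.
move=> d hd; apply/eqP; rewrite eq_le.
rewrite (argmin_polar GB smin) ?andbT; last by move=> i iI; rewrite hd.
rewrite -oppr_ge0 -dotvNr (argmin_polar GB smin) // => i iI.
by rewrite mulmxN mxE hd // oppr0.
Qed.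

(** Both defining conditions are equalities that are continuous along the
    homotopy, so that a violation at [s] persists nearby. *)
Lemma onface_closed I s : 0 <= s <= 1 -> ~ onface I s ->
  exists2 e, 0 < e & forall t, 0 <= t <= 1 -> `|t - s| <= e -> ~ onface I t.
Proof.
move=> s01 nf.
have [hA|/existsNP[i /not_implyP[iI ne]]] := pselect
    (forall i, i \in I -> (A *m Y s) i 0 = (b + s *: r) i 0).
  have [//|/existsNP[d /not_implyP[dI ne]]] := pselect
    (forall d, (forall i, i \in I -> (A *m d) i 0 = 0) -> dotv (D (Y s)) d = 0).
    by move=> h; case: nf.
  have g0 : 0 < `|dotv (D (Y s)) d| by rewrite normr_gt0; apply/eqP.
  have k0 : 0 < `|L| * enorm d + 1 by rewrite ltr_wpDl ?mulr_ge0 ?enorm_ge0.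
  have [e e0 he] := homotopy_continuous s01 (divr_gt0 g0 (mulr_gt0 (ltr0Sn R 1) k0)).
  exists e => // t t01 te [_ /(_ d dI) hd].
  have [h1 _] := he t t01 te.
  have h2 : `|dotv (D (Y s)) d| <= (`|L| * enorm (Y t - Y s)) * enorm d.
    rewrite -normrN -[- _]add0r -hd -dotvBl.
    apply: (@le_trans _ _ (enorm (D (Y t) - D (Y s)) * enorm d)).
      by rewrite ler_norml cauchy_schwarz cauchy_schwarzN.
    rewrite ler_wpM2r ?enorm_ge0 // (le_trans (DL _ _)) //.
    by rewrite ler_wpM2r ?enorm_ge0 ?ler_norm.
  move: h1; rewrite ler_pdivlMr ?mulr_gt0 // => h1.
  have := mulr_ge0 (normr_ge0 L) (enorm_ge0 d); have := enorm_ge0 (Y t - Y s).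
  by lra.
have g0 : 0 < `|(A *m Y s) i 0 - (b + s *: r) i 0|.
  by rewrite normr_gt0 subr_eq0; apply/eqP.
have k0 : 0 < frobenius A + enorm r + 1 by rewrite ltr_wpDl ?addr_ge0 ?frobenius_ge0 ?enorm_ge0.
have [e e0 he] := homotopy_continuous s01 (divr_gt0 g0 (mulr_gt0 (ltr0Sn R 1) k0)).
exists e => // t t01 te [/(_ i iI) hd _].
have [h1 h2] := he t t01 te.
have h3 : `|(A *m Y s) i 0 - (b + s *: r) i 0| <=
    frobenius A * enorm (Y t - Y s) + `|t - s| * enorm r.
  have -> : (A *m Y s) i 0 - (b + s *: r) i 0 =
      (t - s) * r i 0 - (A *m (Y t - Y s)) i 0.
    rewrite mulmxBr [in RHS]mxE [X in _ = _ - (_ + X)]mxE hd !mxE; ring.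
  apply: le_trans (ler_normB _ _) _; rewrite addrC normrM; apply: lerD.
    by apply: le_trans (enorm_coord _ _) _; exact: enorm_mulmx.
  by rewrite ler_wpM2l // enorm_coord.
move: h1 h2 h3; set g := `|_ - (b + _) i 0|; rewrite -/g in g0 *.
rewrite !ler_pdivlMr ?mulr_gt0 // => h1 h2 h3.
have a0 := frobenius_ge0 A; have r0 := enorm_ge0 r.
have ny0 := enorm_ge0 (Y t - Y s); have t0 := normr_ge0 (t - s).
have p1 := mulr_ge0 a0 t0; have p2 := mulr_ge0 r0 ny0.
have e1 : frobenius A * g >= frobenius A * (enorm (Y t - Y s) * (2 * (frobenius A + enorm r + 1))).
  by rewrite ler_wpM2l.
have e2 : enorm r * g >= enorm r * (`|t - s| * (2 * (frobenius A + enorm r + 1))).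
  by rewrite ler_wpM2l.
have e3 : 2 * (frobenius A + enorm r + 1) * g <= (frobenius A + enorm r) * g.
  have := ler_wpM2l (ltW k0) h3; lra.
have : 0 < (frobenius A + enorm r + 1) * g by rewrite mulr_gt0.
lra.
Qed.

(** There are finitely many faces, and those that miss [s] are missed by all
    parameters near [s]. So near [s] every minimizer shares a face with [Y s],
    where [face_lipschitz] applies; the local bounds add up along the homotopy.
    The constant depends only on [A] and the moduli of [G], not on [b] or [r]. *)
Lemma argmin_rhs_lipschitz :
  mu * enorm (y1 - y0) <= `|L| * rhs_const A * enorm r.
Proof.
have Y0 : Y 0 = y0.
  rewrite /Y scale0r addr0; exact: (argmin_unique mu0 GB (@feasible_segment _ _ _ A b)).
have Y1 : Y 1 = y1.
  rewrite /Y scale1r; exact: (argmin_unique mu0 GB (@feasible_segment _ _ _ A (b + r))).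
rewrite -Y0 -Y1 mulrC -ler_pdivlMr //.
apply: lipschitz_of_local => s s01.
have [e e0 he] : exists2 e, 0 < e & forall I t, 0 <= t -> t <= e ->
    ~ onface I s -> forall t', 0 <= t' <= 1 -> `|t' - s| <= t -> ~ onface I t'.
  apply: finite_min_pos => I.
  have [f|/(onface_closed s01)[e e0 he]] := pselect (onface I s); first by exists 1.
  by exists e => // t t0 te _ t' t01 tt; apply: he => //; exact: le_trans te.
exists e => // t t01 te; set I := active A (b + t *: r) (Y t).
have ft := onface_active t01.
have fs : onface I s.
  by apply: contrapT => /(he I e (ltW e0) (lexx e))/(_ t t01 te).
have h := @face_lipschitz _ _ _ A mu M L G D GB DL I r (t - s) (Y t) (Y s) _ ft.2 fs.2.
rewrite -(ler_pM2l mu0); apply: le_trans (h _) _.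
  move=> i iI; rewrite mulmxBr [LHS]mxE [X in _ + X]mxE ft.1 // fs.1 // !mxE; ring.
by rewrite [leRHS]mulrA (mulrC mu) divfK ?gt_eqF // -!mulrA; lra.
Qed.

End Homotopy.

(** * The augmented Lagrangian with slack variables *)

Section BlockDefs.
Context {R : realType} {dx dy dh : nat}.
Implicit Types (G : 'cV[R]_(dx + dy) -> R)
  (D : 'cV[R]_(dx + dy) -> 'cV[R]_(dx + dy)).

Definition smooth_sc (L mu : R) G D : Prop :=
  [/\ forall p q, `|G q - G p - dotv (D p) (q - p)| <= L / 2 * enorm (q - p) ^+ 2,
      forall p q, enorm (D p - D q) <= L * enorm (p - q)
    & forall x y y', G (col_mx x y) + dotv (dsubmx (D (col_mx x y))) (y' - y)
        + mu / 2 * enorm (y' - y) ^+ 2 <= G (col_mx x y')].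

Variables (A : 'M[R]_(dh, dy)) (b : 'cV[R]_dh).

Definition slack_mx : 'M[R]_(dh, dy + dh) := row_mx A (- 1%:M).

(** The penalty parameter is [1], as in [sflcb_choice] below. *)
Definition aug_lag G x (w : 'cV[R]_(dy + dh)) u : R :=
  G (col_mx x (usubmx w)) + dotv u (residual A b w) + 1 / 2 * enorm (residual A b w) ^+ 2.

Definition grad_aug_lag D x (w : 'cV[R]_(dy + dh)) u : 'cV[R]_(dy + dh) :=
  col_mx (dsubmx (D (col_mx x (usubmx w)))) 0 + slack_mx^T *m (u + residual A b w).

Definition w_opt G x u := argmin (@Py R dy dh) (fun w => aug_lag G x w u).
Definition dual_residual G x u : 'cV[R]_dh := residual A b (w_opt G x u).
Definition dual_fun G x u : R := aug_lag G x (w_opt G x u) u.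
Definition primal_fun G (x : 'cV[R]_dx) : R := G (col_mx x (ystar G A b x)).
Definition lag_gap G x w u : R := aug_lag G x w u - dual_fun G x u.
Definition dual_gap G x u : R := primal_fun G x - dual_fun G x u.

(** The Lyapunov function of the inner iteration: suboptimality of [w] for the
    augmented Lagrangian plus suboptimality of [u] for the dual. *)
Definition merit G x w u : R := lag_gap G x w u + dual_gap G x u.
(** What one iteration takes off [merit], up to a constant factor. *)
Definition merit_residual G x w u : R :=
  lag_gap G x w u + enorm (dual_residual G x u) ^+ 2.

End BlockDefs.

Section Block.
Context {R : realType} {dx dy dh : nat}.
Variables (A : 'M[R]_(dh, dy)) (b : 'cV[R]_dh) (L mu : R).
Hypothesis Y0 : feasible A b !=set0.
Hypothesis L0 : 0 < L.
Hypothesis mu0 : 0 < mu.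

Definition lag_modulus : R := Order.min (mu / (1 + 2 * frobenius A ^+ 2)) (1 / 2).
Definition slack_norm : R := frobenius (slack_mx A) + 1.
Definition lag_smooth_const : R := L + slack_norm ^+ 2.

Let gam := lag_modulus.
Let a := slack_norm.
Let M := lag_smooth_const.

Lemma lag_modulus_gt0 : 0 < gam.
Proof. by rewrite lt_min !divr_gt0 // ltr_wpDr // mulr_ge0 ?sqr_ge0. Qed.

Lemma lag_modulus_le_mu : gam <= mu.
Proof.
apply: (@le_trans _ _ (mu / (1 + 2 * frobenius A ^+ 2))); first by rewrite ge_min lexx.
rewrite ler_pdivrMr; last by rewrite ltr_wpDr // mulr_ge0 ?sqr_ge0.
by have := mulr_ge0 (ltW mu0) (sqr_ge0 (frobenius A)); lra.
Qed.

Lemma slack_norm_gt0 : 0 < a.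
Proof. by rewrite /a /slack_norm ltr_wpDl ?frobenius_ge0 ?ltr01. Qed.

Lemma slack_mx_bound (w : 'cV[R]_(dy + dh)) : enorm (slack_mx A *m w) <= a * enorm w.
Proof. by apply: enorm_mulmx_le; rewrite lerDl. Qed.

Lemma residual_sub (w w' : 'cV[R]_(dy + dh)) :
  residual A b w' - residual A b w = slack_mx A *m (w' - w).
Proof. by rewrite /residual mulmxBr opprB addrA subrK. Qed.

Lemma residualE (w : 'cV[R]_(dy + dh)) :
  residual A b w = A *m usubmx w - b - dsubmx w.
Proof.
by rewrite /residual -{1}(vsubmxK w) mul_row_col mulNmx mul1mx addrAC.
Qed.

(** The slack part of [w] is determined by its [y] part and [slack_mx A *m w],
    so the penalty term makes the Lagrangian strongly convex in the slack. *)
Lemma lag_modulus_bound (w : 'cV[R]_(dy + dh)) :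
  gam * enorm w ^+ 2 <= mu * enorm (usubmx w) ^+ 2 + enorm (slack_mx A *m w) ^+ 2.
Proof.
rewrite -{1}(vsubmxK w) enorm_col_mx.
have e : dsubmx w = A *m usubmx w - slack_mx A *m w.
  by rewrite -{3}(vsubmxK w) mul_row_col mulNmx mul1mx opprB addrC subrK.
have h1 : enorm (dsubmx w) ^+ 2 <= 2 * frobenius A ^+ 2 * enorm (usubmx w) ^+ 2
    + 2 * enorm (slack_mx A *m w) ^+ 2.
  have h2 : enorm (A *m usubmx w) ^+ 2 <= frobenius A ^+ 2 * enorm (usubmx w) ^+ 2.
    by rewrite -exprMn ler_pXn2r ?nnegrE ?mulr_ge0 ?frobenius_ge0 ?enorm_ge0 ?enorm_mulmx.
  have := dotv_ge0 (A *m usubmx w + slack_mx A *m w); rewrite e !dotv_lin !dotv_self.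
  move: h2; rewrite !enorm_sqr !dotv_lin !dotv_self !(dotvC (slack_mx A *m w)) /=.
  by rewrite !enorm_sqr; lra.
have g1 : gam * (1 + 2 * frobenius A ^+ 2) <= mu.
  by rewrite -ler_pdivlMr ?ge_min ?lexx // ltr_wpDr // mulr_ge0 ?sqr_ge0.
have g2 : gam * 2 <= 1 by rewrite -ler_pdivlMr // ge_min lexx orbT.
have h3 := ler_wpM2l (ltW lag_modulus_gt0) h1.
have h4 := ler_wpM2r (sqr_ge0 (enorm (usubmx w))) g1.
have h5 := ler_wpM2r (sqr_ge0 (enorm (slack_mx A *m w))) g2.
lra.
Qed.

Lemma Py_closed : closed (@Py R dy dh).
Proof.
have -> : @Py R dy dh = \bigcap_(i in [set: 'I_dh]) [set w | dsubmx w i 0 <= 0].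
  by apply/seteqP; split => y /= h; [move=> i _ /=; exact: h|move=> i; exact: h].
apply: closed_bigI => i _.
apply: (@closed_comp _ _ (fun w : 'cV[R]_(dy + dh) => dsubmx w i 0) [set x | x <= 0]); last exact: closed_le.
by move=> y _; under eq_fun do rewrite mxE; exact: coord_continuous.
Qed.

Lemma Py_segment : segment_closed (@Py R dy dh).
Proof.
move=> y z t t0 t1 hy hz i; have := hy i; have := hz i.
by rewrite !mxE; nra.
Qed.

Lemma Py_neq0 : @Py R dy dh !=set0.
Proof. by exists 0 => i; rewrite !mxE. Qed.

Section Objective.
Variables (G : 'cV[R]_(dx + dy) -> R) (D : 'cV[R]_(dx + dy) -> 'cV[R]_(dx + dy)).
Hypothesis GD : smooth_sc L mu G D.

Lemma smooth_upper p q :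
  G q <= G p + dotv (D p) (q - p) + L / 2 * enorm (q - p) ^+ 2.
Proof. by have [h _ _] := GD; have := h p q; rewrite ler_norml; lra. Qed.

Lemma gradient_lipschitz p q : enorm (D p - D q) <= L * enorm (p - q).
Proof. by case: GD. Qed.

Lemma col_mx_subr (x : 'cV[R]_dx) (y y' : 'cV[R]_dy) :
  col_mx x y' - col_mx x y = col_mx 0 (y' - y).
Proof. by rewrite opp_col_mx add_col_mx subrr. Qed.

Lemma col_mx_subl (x x' : 'cV[R]_dx) (y : 'cV[R]_dy) :
  col_mx x' y - col_mx x y = col_mx (x' - x) 0.
Proof. by rewrite opp_col_mx add_col_mx subrr. Qed.

Lemma enorm_col0 m n (v : 'cV[R]_n) : enorm (col_mx (0 : 'cV[R]_m) v) = enorm v.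
Proof. by rewrite /enorm dotv_col_mx dotv0l add0r. Qed.

Lemma enorm_0col m n (v : 'cV[R]_m) : enorm (col_mx v (0 : 'cV[R]_n)) = enorm v.
Proof. by rewrite /enorm dotv_col_mx dotv0l addr0. Qed.

Lemma dotv_col0 m n (p : 'cV[R]_(m + n)) v : dotv p (col_mx 0 v) = dotv (dsubmx p) v.
Proof. by rewrite -{1}(vsubmxK p) dotv_col_mx dotv0r add0r. Qed.

Lemma dotv_0col m n (p : 'cV[R]_(m + n)) v : dotv p (col_mx v 0) = dotv (usubmx p) v.
Proof. by rewrite -{1}(vsubmxK p) dotv_col_mx dotv0r addr0. Qed.

Lemma objective_quad_bounds x :
  quad_bounds mu L (fun y => G (col_mx x y)) (fun y => dsubmx (D (col_mx x y))).
Proof.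
move=> y y'; split; first by case: GD.
by have := smooth_upper (col_mx x y) (col_mx x y'); rewrite col_mx_subr enorm_col0 dotv_col0.
Qed.

Lemma aug_lag_expand x u w w' :
  aug_lag A b G x w' u - aug_lag A b G x w u - dotv (grad_aug_lag A b D x w u) (w' - w)
  = (G (col_mx x (usubmx w')) - G (col_mx x (usubmx w))
     - dotv (dsubmx (D (col_mx x (usubmx w)))) (usubmx w' - usubmx w))
    + 1 / 2 * enorm (slack_mx A *m (w' - w)) ^+ 2.
Proof.
rewrite /aug_lag /grad_aug_lag.
have -> : residual A b w' = residual A b w + slack_mx A *m (w' - w).
  by rewrite -residual_sub addrC subrK.
rewrite dotvDl (dotvC (_ *m _)) -dotv_mulmx.
rewrite (dotvC (col_mx _ _)) dotv_0col (linearB usubmx) /=.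
rewrite (dotvC (usubmx w' - usubmx w)).
move: (residual A b w) (slack_mx A *m _) (dotv (dsubmx _) _) => r d k.
by rewrite !enorm_sqr !dotvDr !dotvDl (dotvC d u) (dotvC d r); lra.
Qed.

Lemma aug_lag_quad_bounds x u :
  quad_bounds gam M (fun w => aug_lag A b G x w u) (fun w => grad_aug_lag A b D x w u).
Proof.
move=> w w'; have e := aug_lag_expand x u w w'.
have [h1 h2] := objective_quad_bounds x (usubmx w) (usubmx w').
have h3 := lag_modulus_bound (w' - w); rewrite [usubmx (w' - w)]linearB /= in h3.
have h4 : enorm (slack_mx A *m (w' - w)) ^+ 2 <= a ^+ 2 * enorm (w' - w) ^+ 2.
  by rewrite -exprMn ler_pXn2r ?nnegrE ?mulr_ge0 ?enorm_ge0 ?slack_mx_bound ?(ltW slack_norm_gt0).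
have h5 : enorm (usubmx w' - usubmx w) ^+ 2 <= enorm (w' - w) ^+ 2.
  by rewrite ler_pXn2r ?nnegrE ?enorm_ge0 // -[usubmx w' - _]linearB enorm_usubmx.
have h6 := ler_wpM2l (ltW L0) h5.
move: e h1 h2; rewrite /M /lag_smooth_const -/a; cbv beta => e h1 h2; split; lra.
Qed.

Lemma w_optP x u : is_argmin (@Py R dy dh) (fun w => aug_lag A b G x w u) (w_opt A b G x u).
Proof.
exact: (argmin_exists lag_modulus_gt0 (aug_lag_quad_bounds x u) Py_closed Py_neq0).
Qed.

Lemma ystarP x : is_argmin (feasible A b) (fun y => G (col_mx x y)) (ystar G A b x).
Proof.
exact: (argmin_exists mu0 (objective_quad_bounds x) (@feasible_closed _ _ _ A b) Y0).
Qed.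

Lemma lag_gap_growth x w u : Py w ->
  gam / 2 * enorm (w - w_opt A b G x u) ^+ 2 <= lag_gap A b G x w u.
Proof.
move=> Pw; rewrite /lag_gap /dual_fun.
have := argmin_growth (aug_lag_quad_bounds x u) Py_segment (w_optP x u) Pw; lra.
Qed.

Lemma lag_gap_ge0 x w u : Py w -> 0 <= lag_gap A b G x w u.
Proof.
move=> Pw; apply: le_trans (lag_gap_growth x u Pw).
by rewrite mulr_ge0 ?sqr_ge0 // divr_ge0 // ltW // lag_modulus_gt0.
Qed.

Lemma w_opt_lipschitz_u x u u' :
  gam * enorm (w_opt A b G x u' - w_opt A b G x u) <= a * enorm (u' - u).
Proof.
set w := w_opt A b G x u; set w' := w_opt A b G x u'.
have := argmin_sensitivity (aug_lag_quad_bounds x u) (aug_lag_quad_bounds x u')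
  Py_segment (w_optP x u) (w_optP x u').
rewrite -/w -/w' => h1.
have e : grad_aug_lag A b D x w' u - grad_aug_lag A b D x w' u' = (slack_mx A)^T *m (u - u').
  by rewrite /grad_aug_lag opprD addrACA subrr add0r -mulmxBr opprD addrACA subrr addr0.
rewrite e dotvC -dotv_mulmx in h1.
have h2 := cauchy_schwarz (slack_mx A *m (w' - w)) (u - u').
have h3 := ler_wpM2r (enorm_ge0 (u - u')) (slack_mx_bound (w' - w)).
have [->|ne0] := eqVneq (enorm (w' - w)) 0.
  by rewrite mulr0 mulr_ge0 ?enorm_ge0 // ltW // slack_norm_gt0.
have ep : 0 < enorm (w' - w) by rewrite lt_neqAle eq_sym ne0 enorm_ge0.
by rewrite -(ler_pM2r ep) (enormB u'); lra.
Qed.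

Lemma w_opt_lipschitz_x x x' u :
  gam * enorm (w_opt A b G x' u - w_opt A b G x u) <= L * enorm (x' - x).
Proof.
set w := w_opt A b G x u; set w' := w_opt A b G x' u.
have := argmin_sensitivity (aug_lag_quad_bounds x u) (aug_lag_quad_bounds x' u)
  Py_segment (w_optP x u) (w_optP x' u).
rewrite -/w -/w' => h1.
have h2 := cauchy_schwarz (grad_aug_lag A b D x w' u - grad_aug_lag A b D x' w' u) (w' - w).
have h3 : enorm (grad_aug_lag A b D x w' u - grad_aug_lag A b D x' w' u) <= L * enorm (x' - x).
  rewrite /grad_aug_lag opprD addrACA subrr addr0 opp_col_mx add_col_mx subrr enorm_0col.
  rewrite -linearB /=; apply: le_trans (enorm_dsubmx _) _.
  by apply: le_trans (gradient_lipschitz _ _) _; rewrite col_mx_subl enorm_0col enormB.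
have h4 := ler_wpM2r (enorm_ge0 (w' - w)) h3.
have [->|ne0] := eqVneq (enorm (w' - w)) 0.
  by rewrite mulr0 mulr_ge0 ?enorm_ge0 // ltW.
have ep : 0 < enorm (w' - w) by rewrite lt_neqAle eq_sym ne0 enorm_ge0.
by rewrite -(ler_pM2r ep); lra.
Qed.

Lemma ystar_lipschitz x x' : mu * enorm (ystar G A b x' - ystar G A b x) <= L * enorm (x' - x).
Proof.
set w := ystar G A b x; set w' := ystar G A b x'.
have := argmin_sensitivity (objective_quad_bounds x) (objective_quad_bounds x')
  (@feasible_segment _ _ _ A b) (ystarP x) (ystarP x').
rewrite -/w -/w' => h1.
have h2 := cauchy_schwarz (dsubmx (D (col_mx x w')) - dsubmx (D (col_mx x' w'))) (w' - w).
have h3 : enorm (dsubmx (D (col_mx x w')) - dsubmx (D (col_mx x' w'))) <= L * enorm (x' - x).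
  rewrite -linearB /=; apply: le_trans (enorm_dsubmx _) _.
  by apply: le_trans (gradient_lipschitz _ _) _; rewrite col_mx_subl enorm_0col enormB.
have h4 := ler_wpM2r (enorm_ge0 (w' - w)) h3.
have [->|ne0] := eqVneq (enorm (w' - w)) 0.
  by rewrite mulr0 mulr_ge0 ?enorm_ge0 // ltW.
have ep : 0 < enorm (w' - w) by rewrite lt_neqAle eq_sym ne0 enorm_ge0.
by rewrite -(ler_pM2r ep); lra.
Qed.

(** The Lagrangian is affine in [u], with the residual as slope: test the
    minimizer for [u] in the problem for [u']. *)
Lemma dual_fun_upper x u u' :
  dual_fun A b G x u' <= dual_fun A b G x u + dotv (dual_residual A b G x u) (u' - u).
Proof.
apply: le_trans ((w_optP x u').2 _ (w_optP x u).1) _.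
by rewrite /dual_residual /dual_fun /aug_lag dotvBr (dotvC _ u') (dotvC _ u); lra.
Qed.

Lemma weak_duality x u : 0 <= dual_gap A b G x u.
Proof.
have [Ys _] := ystarP x.
have Pw : Py (col_mx (ystar G A b x) (A *m ystar G A b x - b)).
  by move=> i; rewrite col_mxKd; exact: Ys.
have := (w_optP x u).2 _ Pw; rewrite {2}/aug_lag residualE col_mxKu col_mxKd subrr.
by rewrite enorm0 dotv0r expr0n mulr0 !addr0 subr_ge0.
Qed.

(** Among the points of [Py] with the residual of [w_opt], only the value of [G]
    varies; these points are the [y] feasible for the shifted right-hand side. *)
Lemma w_opt_perturbed x u :
  is_argmin (feasible A (b + dual_residual A b G x u))
    (fun y => G (col_mx x y)) (usubmx (w_opt A b G x u)).
Proof.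
rewrite /dual_residual; set w := w_opt A b G x u; set r := residual A b w.
have [Pw wmin] := w_optP x u.
split.
  move=> i; have := Pw i; rewrite -/w.
  have -> : slack A (b + r) (usubmx w) = dsubmx w; last by [].
  by rewrite /slack /r residualE opprD addrA opprB addrC subrK.
move=> y Yy.
have Pz : Py (col_mx y (A *m y - (b + r))) by move=> i; rewrite col_mxKd; exact: Yy.
have := wmin _ Pz; rewrite -/w /aug_lag -/r residualE col_mxKu col_mxKd.
have -> : A *m y - b - (A *m y - (b + r)) = r by rewrite opprB addrC addrA subrK addrDK.
by lra.
Qed.

Definition error_bound_const : R := L * rhs_const A / mu.

Lemma error_bound_const_ge0 : 0 <= error_bound_const.
Proof. by rewrite divr_ge0 ?mulr_ge0 ?rhs_const_ge0 // ltW. Qed.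

(** Both points minimize the same objective over right-hand sides that differ by
    the residual. The constant does not depend on [x] or [u], so that the bound
    can be used along the whole run. *)
Lemma dual_error_bound x u :
  enorm (usubmx (w_opt A b G x u) - ystar G A b x)
    <= error_bound_const * enorm (dual_residual A b G x u).
Proof.
have DL y z : enorm (dsubmx (D (col_mx x y)) - dsubmx (D (col_mx x z))) <= L * enorm (y - z).
  rewrite -linearB /=; apply: le_trans (enorm_dsubmx _) _.
  by apply: le_trans (gradient_lipschitz _ _) _; rewrite col_mx_subr enorm_col0.
have := argmin_rhs_lipschitz mu0 (objective_quad_bounds x) DL (ystarP x) (w_opt_perturbed x u).
rewrite (gtr0_norm L0) => h; rewrite -(ler_pM2l mu0) (le_trans h) //.
by rewrite /error_bound_const mulrA [mu * _]mulrC divfK ?gt_eqF.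
Qed.

Definition envelope_const : R := L / 2 + L * (1 + L / gam).

(** Envelope theorem: testing the minimizer at one point in the problem at the
    other gives the two inequalities, and the Lipschitz dependence of the
    minimizer makes the error quadratic. The term [c] stands for the part of the
    Lagrangian that depends on [x] only through the minimizer. *)
Lemma value_expansion (Y : 'cV[R]_dx -> 'cV[R]_dy) (c v : 'cV[R]_dx -> R) :
  (forall x, v x = G (col_mx x (Y x)) + c x) ->
  (forall x x', v x <= G (col_mx x (Y x')) + c x') ->
  (forall x x', gam * enorm (Y x' - Y x) <= L * enorm (x' - x)) ->
  forall x x', `|v x' - v x - dotv (usubmx (D (col_mx x (Y x)))) (x' - x)|
    <= envelope_const * enorm (x' - x) ^+ 2.
Proof.
move=> vE vle YL x x'.
have g0 := lag_modulus_gt0.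
have up1 := smooth_upper (col_mx x (Y x)) (col_mx x' (Y x)).
have up2 := smooth_upper (col_mx x' (Y x')) (col_mx x (Y x')).
move: up1 up2; rewrite !col_mx_subl !enorm_0col !dotv_0col => up1 up2.
have h1 := vle x' x; have h2 := vle x x'.
set e := enorm (x' - x) in up1 *; rewrite enormB -/e in up2.
have e0 : 0 <= e := enorm_ge0 _.
have h3 : enorm (usubmx (D (col_mx x' (Y x'))) - usubmx (D (col_mx x (Y x))))
    <= L * ((1 + L / gam) * e).
  rewrite -linearB /=; apply: le_trans (enorm_usubmx _) _.
  apply: le_trans (gradient_lipschitz _ _) _; rewrite ler_wpM2l ?(ltW L0) //.
  rewrite opp_col_mx add_col_mx -[x' - x]addr0 -[Y x' - Y x]add0r -add_col_mx.
  apply: le_trans (enormD _ _) _; rewrite enorm_0col enorm_col0 -/e mulrDl mul1r lerD2l.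
  by rewrite mulrAC ler_pdivlMr // mulrC YL.
have h4 := cauchy_schwarzN (usubmx (D (col_mx x' (Y x'))) - usubmx (D (col_mx x (Y x)))) (x' - x).
rewrite dotvBl -/e in h4.
have h5 := ler_wpM2r e0 h3.
have h6 : 0 <= L * ((1 + L / gam) * e) * e.
  by rewrite !mulr_ge0 ?(ltW L0) // addr_ge0 // divr_ge0 // ltW.
move: up2; rewrite -opprB dotvNr => up2.
by rewrite ler_norml /envelope_const (vE x) (vE x') in h1 h2 *; lra.
Qed.

Lemma primal_expansion x x' :
  `|primal_fun A b G x' - primal_fun A b G x
    - dotv (usubmx (D (col_mx x (ystar G A b x)))) (x' - x)| <= envelope_const * enorm (x' - x) ^+ 2.
Proof.
apply: (@value_expansion (ystar G A b) (fun=> 0)) => [z|z z'|z z'].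
- by rewrite addr0.
- by rewrite addr0; apply: (ystarP z).2; exact: (ystarP z').1.
apply: le_trans (ystar_lipschitz z z'); rewrite ler_wpM2r ?enorm_ge0 //; exact: lag_modulus_le_mu.
Qed.

Lemma dual_expansion u x x' :
  `|dual_fun A b G x' u - dual_fun A b G x u
    - dotv (usubmx (D (col_mx x (usubmx (w_opt A b G x u))))) (x' - x)|
  <= envelope_const * enorm (x' - x) ^+ 2.
Proof.
apply: (@value_expansion (fun z => usubmx (w_opt A b G z u))
  (fun z => dotv u (residual A b (w_opt A b G z u)) +
    1 / 2 * enorm (residual A b (w_opt A b G z u)) ^+ 2) (fun z => dual_fun A b G z u)) => [z|z z'|z z'].
- by rewrite addrA.
- by rewrite addrA; apply: (w_optP z u).2; exact: (w_optP z' u).1.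
apply: le_trans (w_opt_lipschitz_x z z' u); rewrite ler_wpM2l ?(ltW lag_modulus_gt0) //.
by rewrite -linearB enorm_usubmx.
Qed.

End Objective.
End Block.

(** * One iteration decreases the merit function *)

Section OneStep.
Context {R : realType} {dx dy dh : nat}.
Variables (A : 'M[R]_(dh, dy)) (b : 'cV[R]_dh) (L mu : R).
Hypothesis Y0 : feasible A b !=set0.
Hypothesis L0 : 0 < L.
Hypothesis mu0 : 0 < mu.

Let gam := lag_modulus A mu.
Let a := slack_norm A.
Let M := lag_smooth_const A L.
Let res_lip : R := a ^+ 2 / gam.

Definition step_y : R := (M + gam)^-1.
Let th : R := gam * step_y.
(** The dual step is small against the contraction factor [th] of the primal
    step, so that the contraction absorbs the errors of the dual step. *)
Definition step_u : R := Order.min (32 * res_lip)^-1 (th * gam / (64 * a ^+ 2)).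
Definition step_dec : R := Order.min (th / 2) (step_u / 32).

Let g0 : 0 < gam := lag_modulus_gt0 A mu0.
Let a0 : 0 < a := slack_norm_gt0 A.

Let M0 : 0 < M.
Proof. by rewrite /M /lag_smooth_const ltr_wpDr // sqr_ge0. Qed.

Let rl0 : 0 < res_lip.
Proof. by rewrite divr_gt0 ?exprn_gt0. Qed.

Lemma step_y_gt0 : 0 < step_y.
Proof. by rewrite invr_gt0 addr_gt0. Qed.

Let th0 : 0 < th.
Proof. by rewrite mulr_gt0 // step_y_gt0. Qed.

Let th1 : th <= 1.
Proof.
rewrite /th /step_y ler_pdivrMr; last exact: addr_gt0.
by rewrite mul1r lerDr ltW.
Qed.

Lemma step_u_gt0 : 0 < step_u.
Proof.
rewrite lt_min invr_gt0 mulr_gt0 //= divr_gt0 // mulr_gt0 // exprn_gt0 //.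
Qed.

Lemma step_dec_gt0 : 0 < step_dec.
Proof. by rewrite lt_min; apply/andP; split; apply: divr_gt0 => //; exact: step_u_gt0. Qed.

Let step_u_res : step_u * res_lip <= 1 / 32.
Proof.
apply: (@le_trans _ _ ((32 * res_lip)^-1 * res_lip)).
  by rewrite ler_wpM2r ?(ltW rl0) // ge_min lexx.
by have -> : (32 * res_lip)^-1 * res_lip = 1 / 32 by field; rewrite gt_eqF.
Qed.

Let step_u_op : step_u * a ^+ 2 * 64 <= th * gam.
Proof.
rewrite -mulrA -ler_pdivlMr ?mulr_gt0 ?exprn_gt0 // (mulrC _ 64).
by rewrite ge_min lexx orbT.
Qed.

Section Objective.
Variables (G : 'cV[R]_(dx + dy) -> R) (D : 'cV[R]_(dx + dy) -> 'cV[R]_(dx + dy)).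
Hypothesis GD : smooth_sc L mu G D.
Implicit Types (x : 'cV[R]_dx) (w : 'cV[R]_(dy + dh)) (u : 'cV[R]_dh).

Local Notation wo := (w_opt A b G).
Local Notation rb := (dual_residual A b G).

(** The residual at [w] differs from the dual gradient at [u] by at most
    [slack_norm * |w - w_opt|], so that the step is an inexact ascent step for the
    dual function. *)
Lemma dual_step x w u : Py w ->
  let u' := u + step_u *: residual A b w in
  let k := a ^+ 2 * enorm (w - wo x u) ^+ 2 in
  let g := enorm (rb x u) ^+ 2 in
  [/\ lag_gap A b G x w u' <= lag_gap A b G x w u + step_u * (3 / 16 * g + 4 * k),
      lag_gap A b G x w u - step_u * (g / 8 + 2 * k) <= lag_gap A b G x w u',
      dual_gap A b G x u' <= dual_gap A b G x u - step_u * (7 / 16 * g - k)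
    & enorm (rb x u') ^+ 2 <= 3 * g + k].
Proof.
move=> Pw u' k g; set rho := residual A b w in u' *.
have s0 := step_u_gt0.
have k0 : 0 <= k by rewrite mulr_ge0 ?sqr_ge0.
have gg0 : 0 <= g by rewrite sqr_ge0.
set p := rho - rb x u.
have pk : enorm p ^+ 2 <= k.
  rewrite /p /rho residual_sub /k -exprMn.
  by rewrite ler_pXn2r ?nnegrE ?mulr_ge0 ?enorm_ge0 ?slack_mx_bound ?(ltW a0).
have rhoE : rho = p + rb x u by rewrite subrK.
have pr1 : dotv p (rb x u) <= g / 8 + 2 * k.
  have := young p (rb x u) (ltr0Sn R 3); rewrite -/g.
  have -> : (2 * 4)^-1 = 1 / 8 :> R by field.
  lra.
have pr2 : - (g / 8 + 2 * k) <= dotv p (rb x u).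
  have := young (- p) (rb x u) (ltr0Sn R 3); rewrite enormN -/g dotvNl.
  have -> : (2 * 4)^-1 = 1 / 8 :> R by field.
  lra.
have rr : enorm rho ^+ 2 <= 2 * g + 2 * k.
  by have := enorm_add_sqr_le p (rb x u); rewrite -rhoE -/g; lra.
set q := rb x u' - rb x u.
have du : u' - u = step_u *: rho by rewrite /u' addrDK.
have qn : enorm q <= res_lip * (step_u * enorm rho).
  have h1 := w_opt_lipschitz_u A b L0 mu0 GD x u u'.
  rewrite du enormZ gtr0_norm // in h1.
  rewrite /q residual_sub; apply: le_trans (slack_mx_bound A _) _.
  rewrite /res_lip mulrAC ler_pdivlMr // expr2 -!mulrA ler_wpM2l ?(ltW a0) //.
  by rewrite mulrC; apply: le_trans h1 _; rewrite -/a; lra.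
have qr : - (step_u * res_lip * enorm rho ^+ 2) <= dotv q rho.
  have := cauchy_schwarzN q rho; have := ler_wpM2r (enorm_ge0 rho) qn; lra.
have qr' : - (g / 16 + k / 16) <= dotv q rho.
  have := ler_wpM2r (sqr_ge0 (enorm rho)) step_u_res; lra.
have up1 := dual_fun_upper A b L0 mu0 GD x u u'.
have up2 := dual_fun_upper A b L0 mu0 GD x u' u.
rewrite du dotvZr in up1.
rewrite -(opprB u') du dotvNr dotvZr in up2.
have r1 : dotv (rb x u) rho = dotv p (rb x u) + g by rewrite rhoE dotvDr dotvC dotv_self.
have r2 : dotv (rb x u') rho = dotv q rho + dotv (rb x u) rho.
  by rewrite /q dotvBl subrK.
have r3 : enorm rho ^+ 2 = enorm p ^+ 2 + 2 * dotv p (rb x u) + g.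
  by rewrite rhoE enorm_add_sqr -/g; lra.
have lagE : aug_lag A b G x w u' = aug_lag A b G x w u + step_u * enorm rho ^+ 2.
  by rewrite /aug_lag -/rho /u' dotvDl dotvZl enorm_sqr; lra.
have pr3 : - (g / 2 + k / 2) <= dotv p (rb x u).
  have := young (- p) (rb x u) ltr01; rewrite enormN -/g dotvNl mulr1; lra.
have f2 : step_u * (7 / 16 * g - k) <= step_u * dotv (rb x u') rho.
  by rewrite ler_wpM2l ?(ltW s0) // r2 r1; lra.
have f3 : step_u * (enorm rho ^+ 2 - dotv (rb x u') rho) <= step_u * (3 / 16 * g + 4 * k).
  by rewrite ler_wpM2l ?(ltW s0) // r2 r1 r3; lra.
have f4 : step_u * (- (g / 8 + 2 * k)) <= step_u * (enorm rho ^+ 2 - dotv (rb x u) rho).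
  by rewrite ler_wpM2l ?(ltW s0) // r1 r3; have := sqr_ge0 (enorm p); lra.
split.
- by rewrite /lag_gap lagE; lra.
- by rewrite /lag_gap lagE; lra.
- by rewrite /dual_gap; lra.
have q2 : enorm q ^+ 2 <= (1 / 32) ^+ 2 * enorm rho ^+ 2.
  rewrite -exprMn ler_pXn2r ?nnegrE ?mulr_ge0 ?enorm_ge0 ?divr_ge0 //.
  by apply: le_trans qn _; have := ler_wpM2r (enorm_ge0 rho) step_u_res; lra.
have -> : rb x u' = q + rb x u by rewrite subrK.
by have := enorm_add_sqr_le q (rb x u); rewrite -/g; lra.
Qed.

Lemma primal_step x w u : Py w ->
  let w' := eproj (@Py R dy dh) (w - step_y *: grad_aug_lag A b D x w u) in
  Py w' /\ lag_gap A b G x w' u <= (1 - th) * lag_gap A b G x w u.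
Proof.
move=> Pw w'; have sy := step_y_gt0.
have Ms : M * step_y <= 1 by rewrite /step_y ler_pdivrMr ?mul1r ?lerDl ?(ltW g0) //; exact: addr_gt0.
exact: (projected_gradient_contraction g0 (aug_lag_quad_bounds A b L0 mu0 GD x u)
  (@Py_closed R dy dh) (@Py_segment R dy dh)
  (w_optP A b L0 mu0 GD x u) Pw sy th1 Ms).
Qed.

Let cv := envelope_const A L mu.
Let eb := error_bound_const A L mu.

(** By the envelope theorem the [x]-gradient of each gap is a difference of
    gradients of [G] at points as close as the current errors. *)
Lemma outer_step x x' w u : Py w ->
  lag_gap A b G x' w u <= lag_gap A b G x w u
    + L * enorm (w - wo x u) * enorm (x' - x) + (L / 2 + cv) * enorm (x' - x) ^+ 2 /\
  dual_gap A b G x' u <= dual_gap A b G x u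
    + L * (eb * enorm (rb x u)) * enorm (x' - x) + 2 * cv * enorm (x' - x) ^+ 2.
Proof.
move=> Pw; set e := enorm (x' - x).
have e0 : 0 <= e := enorm_ge0 _.
have d1 := dual_expansion A b L0 mu0 GD u x x'.
have p1 := primal_expansion Y0 L0 mu0 GD x x'.
rewrite -/e -/cv ler_norml in d1; rewrite -/e -/cv ler_norml in p1.
have gl := gradient_lipschitz GD.
have grad_diff y y' : dotv (usubmx (D (col_mx x y))) (x' - x) -
    dotv (usubmx (D (col_mx x y'))) (x' - x) <= L * enorm (y - y') * e.
  rewrite -dotvBl; apply: le_trans (cauchy_schwarz _ _) _; rewrite ler_wpM2r //.
  rewrite -linearB /=; apply: le_trans (enorm_usubmx _) _.
  by apply: le_trans (gl _ _) _; rewrite col_mx_subr enorm_col0.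
split.
  have s1 := smooth_upper GD (col_mx x (usubmx w)) (col_mx x' (usubmx w)).
  rewrite col_mx_subl enorm_0col dotv_0col -/e in s1.
  have s2 := grad_diff (usubmx w) (usubmx (wo x u)).
  have s3 : L * enorm (usubmx w - usubmx (wo x u)) * e <= L * enorm (w - wo x u) * e.
    by rewrite ler_wpM2r // ler_wpM2l ?(ltW L0) // -linearB enorm_usubmx.
  rewrite /lag_gap /aug_lag; lra.
have s2 := grad_diff (ystar G A b x) (usubmx (wo x u)).
have s3 : L * enorm (ystar G A b x - usubmx (wo x u)) * e <= L * (eb * enorm (rb x u)) * e.
  rewrite ler_wpM2r // ler_wpM2l ?(ltW L0) // enormB.
  exact: (dual_error_bound Y0 L0 mu0 GD x u).
rewrite /dual_gap; lra.
Qed.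

Definition step_drift : R :=
  L / 2 + 3 * cv + 2 * L ^+ 2 / (th * gam) + 6 * (L * eb) ^+ 2 / step_u.

(** The outer displacement is arbitrary, so that the same inequality serves the
    iteration with fixed [x] and the full one. The cross terms between the
    displacement and the errors are split by the inequality of arithmetic and
    geometric means, and part of the decrease pays for the errors. *)
Lemma merit_decrease x x' w u : Py w ->
  let u' := u + step_u *: residual A b w in
  let w' := eproj (@Py R dy dh) (w - step_y *: grad_aug_lag A b D x w u') in
  Py w' /\
  merit A b G x' w' u' <= merit A b G x w u
    - step_dec * merit_residual A b G x w u
    + step_drift * enorm (x' - x) ^+ 2.
Proof.
move=> Pw u' w'.
have [d1 d2 d3 d4] := dual_step x u Pw.
have [Pw' p1] := primal_step x u' Pw.
rewrite -/u' -/w' in d1 d2 d3 d4 p1 Pw'.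
have [ ot1 ot2] := outer_step x x' u' Pw'.
split => //.
set k := a ^+ 2 * _ in d1 d2 d3 d4; set g := enorm (rb x u) ^+ 2 in d1 d2 d3 d4 *.
set v := lag_gap A b G x w u in d1 d2 *; set v' := lag_gap A b G x w u' in d1 d2 p1.
set v'' := lag_gap A b G x w' u' in p1 ot1.
set e' := enorm (w' - wo x u') in ot1; set X := enorm (x' - x) in ot1 ot2 *.
set r' := enorm (rb x u') in d4 ot2.
have s0 := step_u_gt0.
have gr1 := lag_gap_growth A b L0 mu0 GD x u Pw.
have gr2 := lag_gap_growth A b L0 mu0 GD x u' Pw'.
rewrite -/gam -/v -/v'' -/e' in gr1 gr2.
have gg : 0 <= g by rewrite sqr_ge0.
have v0 : 0 <= v by apply: le_trans gr1; rewrite mulr_ge0 ?sqr_ge0 // divr_ge0 // ltW.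
have v''0 : 0 <= v'' by apply: le_trans gr2; rewrite mulr_ge0 ?sqr_ge0 // divr_ge0 // ltW.
have X0 : 0 <= X := enorm_ge0 _.
(* the dual step is small enough for its errors to be absorbed *)
have kv : 32 * (step_u * k) <= th * v.
  have h1 := ler_wpM2r (sqr_ge0 (enorm (w - wo x u))) step_u_op.
  have h2 := ler_wpM2l (ltW th0) gr1.
  rewrite /k; lra.
have y1 : L * e' * X <= th * gam / 8 * e' ^+ 2 + 2 * L ^+ 2 / (th * gam) * X ^+ 2.
  have c0 : 0 < th * gam by rewrite mulr_gt0.
  have := sqr_ge0 (th * gam * e' - 4 * L * X) => h.
  rewrite -(ler_pM2l c0) mulrDr.
  have -> : th * gam * (2 * L ^+ 2 / (th * gam) * X ^+ 2) = 2 * L ^+ 2 * X ^+ 2.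
    by field; rewrite !gt_eqF.
  lra.
have y2 : L * (eb * r') * X <= step_u / 24 * r' ^+ 2 + 6 * (L * eb) ^+ 2 / step_u * X ^+ 2.
  have := sqr_ge0 (step_u * r' - 12 * (L * eb) * X) => h.
  rewrite -(ler_pM2l s0) mulrDr.
  have -> : step_u * (6 * (L * eb) ^+ 2 / step_u * X ^+ 2) = 6 * (L * eb) ^+ 2 * X ^+ 2.
    by field; rewrite gt_eqF.
  lra.
have r'2 : step_u / 24 * r' ^+ 2 <= step_u / 24 * (3 * g + k).
  by rewrite ler_wpM2l // divr_ge0 // ltW.
have k0 : 0 <= step_u * k by rewrite mulr_ge0 ?(ltW s0) // mulr_ge0 ?sqr_ge0.
have sg0 : 0 <= step_u * g by rewrite mulr_ge0 // ltW.
have thv' : th * (v - step_u * (g / 8 + 2 * k)) <= th * v' by rewrite ler_wpM2l // ltW.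
have tg : th * (step_u * g) <= step_u * g by rewrite -[leRHS]mul1r ler_wpM2r.
have tk : th * (step_u * k) <= step_u * k by rewrite -[leRHS]mul1r ler_wpM2r.
have v'0 : 0 <= v' := lag_gap_ge0 A b L0 mu0 GD x u' Pw.
have thv'0 : 0 <= th * v' by rewrite mulr_ge0 // ltW.
have thv'' : th * v'' <= th * v' by rewrite ler_wpM2l ?(ltW th0) //; lra.
have thgr := ler_wpM2l (ltW th0) gr2.
have dec1 : step_dec * v <= th / 2 * v by rewrite ler_wpM2r // ge_min lexx.
have dec2 : step_dec * g <= step_u / 32 * g by rewrite ler_wpM2r // ge_min lexx orbT.
rewrite /merit /merit_residual -/v -/g /step_drift; lra.
Qed.

End Objective.
End OneStep.

(** * Accuracy at small residuals *)

Section Licq.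
Context {R : realType} {dy dh : nat} (A : 'M[R]_(dh, dy)) (b : 'cV[R]_dh).

(** Its rows are free exactly when the rows of [A] in [J] are; the second
    block records the coordinates outside [J]. *)
Definition licq_mx (J : {set 'I_dh}) : 'M[R]_(dh, dy + dh) :=
  row_mx (mask_rows J A) (mask_rows (~: J) 1%:M).

Definition licq_const : R := \sum_J frobenius (pinvmx (licq_mx J))^T.

Lemma licq_const_ge0 : 0 <= licq_const.
Proof. by apply: sumr_ge0 => J _; exact: frobenius_ge0. Qed.

Lemma licq_row_free y : licq A b y -> row_free (licq_mx (active A b y)).
Proof.
set J := active A b y => fr.
apply: inj_row_free => v; rewrite mul_mx_row -row_mx0 => /eq_row_mx[vA vC].
have vout i : i \notin J -> v 0 i = 0.
  move=> iJ; have := congr1 (fun B : 'rV_dh => B 0 i) vC.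
  rewrite !mxE (bigD1 i) //= big1 ?addr0 => [|j ji].
    by rewrite !mxE inE iJ eqxx mulr1.
  by rewrite !mxE (negPf ji) if_same mulr0.
have vin : \sum_(i in J) v 0 i *: row i A = 0.
  rewrite -[RHS]vA; apply/matrixP => k j; rewrite ord1 summxE mxE big_mkcond.
  by apply: eq_bigr => i _; rewrite !mxE; case: ifP => // _; rewrite mulr0.
have vJ i : i \in J -> v 0 i = 0.
  move=> iJ; pose X := in_tuple [seq row i A | i in J].
  have sX : size [seq row i A | i in J] = size (enum J) by rewrite size_map.
  have /freeP/(_ (fun j => v 0 (nth i (enum J) j))) : free X by exact: fr.
  have -> : \sum_(j < size [seq row i A | i in J]) v 0 (nth i (enum J) j) *: X`_j
      = \sum_(i in J) v 0 i *: row i A.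
    rewrite -[RHS]big_enum [RHS](big_nth i) /= [RHS]big_mkord -sX; apply: eq_bigr => j _.
    by rewrite /X /= (nth_map i) // -sX.
  move=> /(_ vin) h.
  have hi : (index i (enum J) < size [seq row i A | i in J])%N.
    by rewrite sX index_mem mem_enum.
  by have := h (Ordinal hi); rewrite /= nth_index // mem_enum.
by apply/matrixP => k i; rewrite ord1 mxE; have [/vJ|/vout] := boolP (i \in J).
Qed.

(** A right inverse of [licq_mx] recovers [lam] from [A^T *m lam] and its zero
    coordinates; summing over all [J] makes the constant independent of the
    active set. *)
Lemma licq_bound y (lam : 'cV[R]_dh) : licq A b y ->
  (forall i, i \notin active A b y -> lam i 0 = 0) ->
  enorm lam <= licq_const * enorm (A^T *m lam).
Proof.
move=> /licq_row_free fr supp; set J := active A b y in fr supp.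
have e : lam^T *m licq_mx J = row_mx (A^T *m lam)^T 0.
  rewrite mul_mx_row; congr row_mx.
    rewrite trmx_mul trmxK; apply/matrixP => k j; rewrite ord1 !mxE; apply: eq_bigr => i _.
    by rewrite !mxE; case: ifP => // iJ; rewrite supp ?iJ // !mul0r.
  apply/matrixP => k j; rewrite ord1 !mxE big1 // => i _.
  by rewrite !mxE inE; case: ifP => iJ; rewrite ?mulr0 // supp // mul0r.
have -> : lam = (pinvmx (licq_mx J))^T *m col_mx (A^T *m lam) 0.
  by apply: trmx_inj; rewrite trmx_mul trmxK tr_col_mx trmx0 -e -mulmxA mulmxVp // mulmx1.
apply: le_trans (enorm_mulmx _ _) _; rewrite enorm_0col.
have -> : A^T *m ((pinvmx (licq_mx J))^T *m col_mx (A^T *m lam) 0) = A^T *m lam.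
  congr (_ *m _); symmetry; apply: trmx_inj.
  by rewrite trmx_mul trmxK tr_col_mx trmx0 -e -mulmxA mulmxVp // mulmx1.
rewrite ler_wpM2r ?enorm_ge0 //.
by rewrite /licq_const (bigD1 J) //= lerDl sumr_ge0 // => K _; exact: frobenius_ge0.
Qed.

End Licq.

Section Accuracy.
Context {R : realType} {dx dy dh : nat}.
Variables (A : 'M[R]_(dh, dy)) (b : 'cV[R]_dh) (L mu : R).
Hypothesis Y0 : feasible A b !=set0.
Hypothesis L0 : 0 < L.
Hypothesis mu0 : 0 < mu.
Variables (G : 'cV[R]_(dx + dy) -> R) (D : 'cV[R]_(dx + dy) -> 'cV[R]_(dx + dy)).
Hypothesis GD : smooth_sc L mu G D.
Variable x : 'cV[R]_dx.

Let gam := lag_modulus A mu.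
Let a := slack_norm A.
Let eb := error_bound_const A L mu.
Let ys := ystar G A b x.
Local Notation wo := (w_opt A b G x).
Local Notation rb := (dual_residual A b G x).
Let g0 : 0 < gam := lag_modulus_gt0 A mu0.
Let QB := aug_lag_quad_bounds A b L0 mu0 GD x.
Let WP := w_optP A b L0 mu0 GD x.
Let YP := ystarP Y0 mu0 GD x.

(** Minimize the strongly convex lower bound at [w]. Unlike the gap itself, the
    gradient is explicit, hence bounded uniformly in [delta]. *)
Lemma lag_gap_le_grad w u :
  lag_gap A b G x w u <= enorm (grad_aug_lag A b D x w u) ^+ 2 / (2 * gam).
Proof.
have [h _] := QB u w (wo u); cbv beta in h; rewrite -/gam in h.
have := young (- grad_aug_lag A b D x w u) (wo u - w) (_ : 0 < gam^-1).
rewrite invr_gt0 dotvNl enormN => /(_ g0).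
have -> : (2 / gam)^-1 = gam / 2 by rewrite invfM invrK mulrC.
have -> : gam^-1 / 2 = (2 * gam)^-1 by rewrite invfM mulrC.
by rewrite /lag_gap /dual_fun; lra.
Qed.

Lemma dual_gap_le_lag_gap y u : feasible A b y ->
  dual_gap A b G x u <= lag_gap A b G x (col_mx y (A *m y - b)) u.
Proof.
move=> Yy; rewrite /dual_gap /lag_gap lerD2r /aug_lag residualE col_mxKu col_mxKd subrr.
by rewrite enorm0 dotv0r expr0n mulr0 !addr0; exact: YP.2.
Qed.

Lemma grad_partial y : grad (fun y => G (col_mx x y)) y = dsubmx (D (col_mx x y)).
Proof.
apply: (grad_quadratic (M := L / 2)) => q.
have [h _ _] := GD; have := h (col_mx x y) (col_mx x q).
by rewrite col_mx_subr enorm_col0 dotv_col0.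
Qed.

Lemma multiplierP : is_multiplier G A b x (multiplier G A b x).
Proof.
apply: getPex.
have [u [u0 uD us]] := multiplier_exists (objective_quad_bounds GD x) YP.
by exists u; split => //; rewrite grad_partial.
Qed.

Let um := multiplier G A b x.

(** On [Py] the multiplier makes the Lagrangian at least the optimal value:
    convexity handles the [y] part and the sign of the multiplier the slack. *)
Lemma strong_duality : primal_fun A b G x <= dual_fun A b G x um.
Proof.
have [u0 uD us] := multiplierP; rewrite -/um grad_partial -/ys in uD us.
rewrite /dual_fun; set w := w_opt _ _ _ _ _; have Pw := (WP um).1; rewrite -/w in Pw.
have [h _] := objective_quad_bounds GD x ys (usubmx w).
cbv beta in h.
have e : dotv um (residual A b w) = dotv (A^T *m um) (usubmx w - ys)
    + dotv um (slack A b ys) - dotv um (dsubmx w).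
  rewrite dotvC (dotvC (A^T *m um)) -dotv_mulmx (dotvC um (slack _ _ _)) (dotvC um (dsubmx w)).
  rewrite -dotvDl -dotvBl residualE /slack mulmxBr; congr (dotv (_ - _) _).
  by rewrite addrA subrK.
have e1 : dotv um (slack A b ys) = 0 by rewrite /dotv big1 // => i _; exact: us.
have e2 : dotv um (dsubmx w) <= 0.
  by apply: sumr_le0 => i _; rewrite mulr_ge0_le0 //; exact: Pw.
have e3 : dotv (dsubmx (D (col_mx x ys))) (usubmx w - ys) + dotv (A^T *m um) (usubmx w - ys) = 0.
  by rewrite -dotvDl uD dotv0l.
have n1 := sqr_ge0 (enorm (residual A b w)).
have n2 := mulr_ge0 (ltW mu0) (sqr_ge0 (enorm (usubmx w - ys))).
by rewrite /primal_fun -/ys /aug_lag e e1; lra.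
Qed.

(** Concavity of the dual function between [u] and the multiplier, where the
    dual gap vanishes. *)
Lemma dual_gap_le_multiplier u :
  dual_gap A b G x u <= enorm (rb u) * enorm (u - um).
Proof.
have h1 := dual_fun_upper A b L0 mu0 GD x u um.
have h2 := cauchy_schwarz (rb u) (um - u).
have h3 := strong_duality.
rewrite (enormB um) in h2; rewrite /dual_gap; lra.
Qed.

(** [u + dual_residual] is the multiplier of the perturbed problem solved by the
    [y] part of [w_opt]; both claims follow from moving in directions [d] for
    which [w_opt + d] and [w_opt - d] are in [Py]. *)
Lemma w_opt_multiplier u : let lam := u + rb u in
  dsubmx (D (col_mx x (usubmx (wo u)))) + A^T *m lam = 0 /\
  forall i, dsubmx (wo u) i 0 < 0 -> lam i 0 = 0.
Proof.
move=> lam; set w := wo u.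
have VI := argmin_variational (QB u) (@Py_segment R dy dh) (WP u); rewrite -/w in VI.
have Pw : Py w := (WP u).1.
have gE h k : dotv (grad_aug_lag A b D x w u) (col_mx h k) =
    dotv (dsubmx (D (col_mx x (usubmx w))) + A^T *m lam) h - dotv lam k.
  rewrite /grad_aug_lag dotvDl dotv_col_mx dotv0l addr0 dotvDl -addrA; congr (_ + _).
  rewrite -/(rb u) -/lam dotvC -dotv_mulmx mul_row_col mulNmx mul1mx dotvBl.
  by rewrite dotv_mulmx dotvC (dotvC k).
have free_dir d : Py (w + d) -> Py (w - d) -> dotv (grad_aug_lag A b D x w u) d = 0.
  move=> /VI; rewrite addrDK => h1 /VI; rewrite addrDK dotvNr oppr_ge0 => h2.
  by apply/eqP; rewrite eq_le h1 h2.
split.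
  set v := _ + A^T *m lam.
  have := free_dir (col_mx v 0); rewrite gE -/v dotv0r subr0 => h.
  apply: enorm_eq0; apply/eqP; rewrite -sqrf_eq0 enorm_sqr; apply/eqP; apply: h => i.
    by rewrite (linearD dsubmx) /= col_mxKd addr0; exact: Pw.
  by rewrite (linearB dsubmx) /= col_mxKd subr0; exact: Pw.
move=> i wi; pose s := - dsubmx w i 0.
have := free_dir (col_mx 0 (s *: delta_mx i 0)); rewrite gE dotv0r dotvZr dotv_delta sub0r.
have Pd (k : R) : `|k| <= 1 -> Py (w + col_mx 0 ((k * s) *: delta_mx i 0)).
  rewrite ler_norml => /andP[k1 k2] j.
  rewrite (linearD dsubmx) /= col_mxKd !mxE -/w.
  have := Pw j; rewrite !mxE; have [->|ji] := eqVneq j i; last by rewrite /= mulr0 addr0.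
  by rewrite /= mulr1 /s mxE; move: wi; rewrite mxE; nra.
have h1 : Py (w + col_mx 0 (s *: delta_mx i 0)) by have := Pd 1; rewrite normr1 mul1r; apply.
have h2 : Py (w - col_mx 0 (s *: delta_mx i 0)).
  by have := Pd (-1); rewrite normrN1 mulN1r scaleNr opp_col_mx oppr0; apply.
move=> /(_ h1 h2) /eqP; rewrite oppr_eq0 mulf_eq0 => /orP[|/eqP//].
by rewrite oppr_eq0 => /eqP h; move: wi; rewrite h ltxx.
Qed.

(** When the residuals are at most [id_const * eps], the slack part of [w_opt]
    differs from the constraint values at the solution by at most [eps / 2],
    half the distance to an inactive constraint. *)
Definition id_const : R := (2 * (a * eb + 1))^-1.
Definition w_const : R := 1 + 2 / gam.
Definition acc_const : R :=
  w_const + eb + (a * w_const + 1) + (licq_const A * (L * eb) + 1).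

Let eb0 : 0 <= eb := error_bound_const_ge0 A L0 mu0.
Let a0 : 0 < a := slack_norm_gt0 A.

Lemma id_const_gt0 : 0 < id_const.
Proof. by rewrite invr_gt0 mulr_gt0 // ltr_wpDl // mulr_ge0 // ltW. Qed.

Let w_const_ge1 : 1 <= w_const.
Proof. by rewrite lerDl divr_ge0 // ltW. Qed.

Let lc0 : 0 <= licq_const A * (L * eb).
Proof. by rewrite mulr_ge0 ?licq_const_ge0 // mulr_ge0 // ltW. Qed.

Lemma acc_const_gt0 : 0 < acc_const.
Proof.
have h := mulr_ge0 (ltW a0) (le_trans ler01 w_const_ge1).
by rewrite /acc_const; move: lc0 w_const_ge1 eb0; lra.
Qed.

(** Once the residuals are small compared with the distance to the inactive
    constraints, the active set is identified and the multiplier is recovered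
    through the free rows. *)
Lemma block_accuracy w u eps : Py w -> 0 < eps -> licq A b ys ->
  (forall i, i \notin active A b ys -> eps <= `|slack A b ys i 0|) ->
  merit_residual A b G x w u <= (id_const * eps) ^+ 2 ->
  [/\ enorm (usubmx w - ys) <= acc_const * (id_const * eps),
      enorm (rb u) <= acc_const * (id_const * eps),
      enorm (residual A b w) <= acc_const * (id_const * eps)
    & enorm (u - um) <= acc_const * (id_const * eps)].
Proof.
rewrite /merit_residual => Pw e0 lq gap small; set t := id_const * eps in small *.
have t0 : 0 < t by rewrite mulr_gt0 // id_const_gt0.
have gr := lag_gap_growth A b L0 mu0 GD x u Pw.
rewrite -/gam in gr.
have r0 := enorm_ge0 (rb u); have r2 := sqr_ge0 (enorm (rb u)).
have E2 := sqr_ge0 (enorm (w - wo u)).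
have gE2 : 0 <= gam / 2 * enorm (w - wo u) ^+ 2 by rewrite mulr_ge0 // divr_ge0 // ltW.
have rt : enorm (rb u) <= t.
  by apply: enorm_le; [exact: ltW|rewrite dotv_self; lra].
have Et : enorm (w - wo u) <= w_const * t.
  have wc0 : 0 <= w_const := le_trans ler01 w_const_ge1.
  apply: enorm_le; first by rewrite mulr_ge0 // ltW.
  rewrite dotv_self exprMn.
  have h1 : enorm (w - wo u) ^+ 2 <= 2 / gam * t ^+ 2.
    rewrite -(ler_pM2l (_ : 0 < gam / 2)) ?divr_gt0 // [leRHS]mulrA.
    have -> : gam / 2 * (2 / gam) = 1 by field; rewrite gt_eqF.
    lra.
  apply: le_trans h1 _; rewrite ler_wpM2r ?sqr_ge0 // /w_const.
  have h2 : 0 <= 2 / gam by rewrite divr_ge0 // ltW.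
  nra.
have ebd := dual_error_bound Y0 L0 mu0 GD x u.
rewrite -/ys -/eb in ebd.
have ebt : enorm (usubmx (wo u) - ys) <= eb * t.
  by apply: le_trans ebd _; rewrite ler_wpM2l.
have awt : 0 <= a * w_const by rewrite mulr_ge0 ?(ltW a0) // (le_trans ler01).
have ebt0 : 0 <= eb * t by rewrite mulr_ge0 // ltW.
have awt0 : 0 <= a * w_const * t by rewrite mulr_ge0 // ltW.
have lct0 : 0 <= licq_const A * (L * eb) * t by rewrite mulr_ge0 ?lc0 // ltW.
have wct0 : t <= w_const * t by rewrite ler_peMl // ltW.
have accE : acc_const * t = w_const * t + eb * t + (a * w_const * t + t)
    + (licq_const A * (L * eb) * t + t) by rewrite /acc_const; ring.
have y1 : enorm (usubmx w - ys) <= w_const * t + eb * t.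
  apply: le_trans (enormBD (usubmx (wo u)) _ _) _; apply: lerD => //.
  by apply: le_trans Et; rewrite -linearB enorm_usubmx.
have rw : enorm (residual A b w) <= a * w_const * t + t.
  have -> : residual A b w = slack_mx A *m (w - wo u) + rb u.
    by rewrite -(residual_sub A b) subrK.
  apply: le_trans (enormD _ _) _; apply: lerD => //.
  by apply: le_trans (slack_mx_bound A _) _; rewrite -mulrA ler_wpM2l // ltW.
have [lamD lam0] := w_opt_multiplier u.
set lam := u + rb u in lamD lam0.
have supp i : i \notin active A b ys -> lam i 0 = 0.
  move=> iJ; apply: lam0; have sl := YP.1 i; rewrite -/ys in sl.
  have gi := gap i iJ; rewrite ler0_norm // in gi.
  have -> : dsubmx (wo u) i 0 = slack A b ys i 0 + (A *m (usubmx (wo u) - ys)) i 0 - rb u i 0.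
    rewrite /dual_residual residualE /slack mulmxBr !mxE; ring.
  have h1 : `|(A *m (usubmx (wo u) - ys)) i 0| <= a * (eb * t).
    apply: le_trans (enorm_coord _ _) _; apply: (@le_trans _ _ (frobenius A * enorm (usubmx (wo u) - ys))).
      exact: enorm_mulmx.
    apply: ler_pM; rewrite ?frobenius_ge0 ?enorm_ge0 //.
    apply: (@le_trans _ _ (frobenius (slack_mx A))); last by rewrite lerDl.
    rewrite ler_sqrt; last by apply: sumr_ge0 => j _; apply: sumr_ge0 => k _; exact: sqr_ge0.
    apply: ler_sum => j _; rewrite big_split_ord /= -[leLHS]addr0; apply: lerD.
      by apply: ler_sum => k _; rewrite row_mxEl.
    by apply: sumr_ge0 => k _; exact: sqr_ge0.
  have h2 := le_trans (enorm_coord (rb u) i) rt.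
  have h3 : (a * eb + 1) * t = eps / 2.
    rewrite /t /id_const; field; rewrite gt_eqF // ltr_wpDl // mulr_ge0 // ltW //.
  by move: h1 h2; rewrite !ler_norml; lra.
have [_ uD us] := multiplierP; rewrite -/um grad_partial -/ys in uD us.
have suppd i : i \notin active A b ys -> (lam - um) i 0 = 0.
  move=> iJ; have := us i => /eqP; rewrite mulf_eq0 => /orP[/eqP umi|]; last first.
    by move: iJ; rewrite inE => /negPf ->.
  by rewrite mxE [X in _ + X]mxE umi subr0; exact: supp.
have lb := licq_bound lq suppd.
have dl : A^T *m (lam - um) = dsubmx (D (col_mx x ys)) - dsubmx (D (col_mx x (usubmx (wo u)))).
  rewrite mulmxBr.
  have -> : A^T *m lam = - dsubmx (D (col_mx x (usubmx (wo u)))).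
    by apply/eqP; rewrite -addr_eq0 addrC lamD.
  have -> : A^T *m um = - dsubmx (D (col_mx x ys)) by apply/eqP; rewrite -addr_eq0 addrC uD.
  by rewrite opprK addrC.
have dn : enorm (A^T *m (lam - um)) <= L * (eb * t).
  rewrite dl -linearB /=; apply: le_trans (enorm_dsubmx _) _.
  apply: le_trans (gradient_lipschitz GD _ _) _.
  by rewrite col_mx_subr enorm_col0 enormB ler_wpM2l // ltW.
have u1 : enorm (u - um) <= licq_const A * (L * eb) * t + t.
  have -> : u - um = (lam - um) - rb u by rewrite /lam addrAC addrK.
  apply: le_trans (enormD _ _) _; rewrite enormN; apply: lerD => //.
  by apply: le_trans lb _; have := ler_wpM2l (licq_const_ge0 A) dn; rewrite !mulrA.
by split; rewrite accE; lra.
Qed.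


End Accuracy.

(** * The iteration SFLCB and its potential *)

Section ArgminTransfer.
Context {R : realType}.

Lemma argmin_ext (T : pointedType) (S : set T) (F F' : T -> R) :
  (forall y z, (F y <= F z) = (F' y <= F' z)) -> argmin S F = argmin S F'.
Proof.
move=> h; rewrite /argmin; congr get; apply/seteqP.
by split => y [Sy ymin]; split => // z Sz; have := ymin z Sz; rewrite h.
Qed.

Lemma argmax_argmin (T : pointedType) (S : set T) (F F' : T -> R) :
  (forall y z, (F z <= F y) = (F' y <= F' z)) -> argmax S F = argmin S F'.
Proof.
move=> h; rewrite /argmin /argmax; congr get; apply/seteqP.
by split => y [Sy ymin]; split => // z Sz; have := ymin z Sz; rewrite h.
Qed.

Lemma grad_quad_bounds n gam M (F : 'cV[R]_n -> R) DF (F' : 'cV[R]_n -> R) k w :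
  0 <= gam -> quad_bounds gam M F DF -> (forall z, F' z = F z + k) -> grad F' w = DF w.
Proof.
move=> g0 FB FE; apply: (grad_quadratic (M := M / 2)) => q; rewrite !FE.
have [h1 h2] := FB w q; have h3 := mulr_ge0 g0 (sqr_ge0 (enorm (q - w))).
rewrite ger0_norm; lra.
Qed.

Lemma grad_quad_bounds_opp n gam M (F : 'cV[R]_n -> R) DF (F' : 'cV[R]_n -> R) k w :
  0 <= gam -> quad_bounds gam M F DF -> (forall z, F' z = k - F z) -> grad F' w = - DF w.
Proof.
move=> g0 FB FE; apply: (grad_quadratic (M := M / 2)) => q; rewrite !FE dotvNl.
have [h1 h2] := FB w q; have h3 := mulr_ge0 g0 (sqr_ge0 (enorm (q - w))).
rewrite ler0_norm; lra.
Qed.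

End ArgminTransfer.

Section Algorithm.
Context {R : realType} {dx dy dh : nat}.
Variables (f g : 'cV[R]_(dx + dy) -> R) (A : 'M[R]_(dh, dy)) (b : 'cV[R]_dh).
Variables (Df Dg : 'cV[R]_(dx + dy) -> 'cV[R]_(dx + dy)).
Variables (L mu delta : R).
Hypothesis Y0 : feasible A b !=set0.
Hypothesis L0 : 0 < L.
Hypothesis mu0 : 0 < mu.
Hypothesis delta0 : 0 < delta.

Local Notation gd := (gdelta f g delta).

Hypothesis Hd : smooth_sc L mu gd Df.
Hypothesis Hg : smooth_sc L mu g Dg.

(** The step sizes depend on [A] and on moduli common to [g] and [delta f + g],
    hence not on [delta]. *)
Definition sflcb_choice (ex : R) : sflcb_params R :=
  SflcbParams 1 1 ex (step_y A L mu) (step_y A L mu) (step_u A L mu) (step_u A L mu).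

Variable ex : R.
Local Notation c := (sflcb_choice ex).
Let g0 : 0 <= lag_modulus A mu := ltW (lag_modulus_gt0 A mu0).

Lemma K_split x yp zp u v :
  K f g A b delta c x yp zp u v = aug_lag A b gd x yp u - aug_lag A b g x zp v.
Proof. by rewrite /K /aug_lag /gdelta /=; lra. Qed.

Lemma fixed_stepE x (s : iterate R dy dh) :
  let u := it_u s + step_u A L mu *: residual A b (it_y s) in
  let v := it_v s + step_u A L mu *: residual A b (it_z s) in
  sflcb_fixed_step f g A b delta c x s = Iterate
    (eproj (@Py R dy dh) (it_y s - step_y A L mu *: grad_aug_lag A b Df x (it_y s) u))
    (eproj (@Py R dy dh) (it_z s - step_y A L mu *: grad_aug_lag A b Dg x (it_z s) v)) u v.
Proof.
move=> u v.
have e1 : grad (fun yp => K f g A b delta c x yp (it_z s) u v) (it_y s) =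
    grad_aug_lag A b Df x (it_y s) u.
  apply: (grad_quad_bounds _ g0 (aug_lag_quad_bounds A b L0 mu0 Hd x u)
    (k := - aug_lag A b g x (it_z s) v)) => z; exact: K_split.
have e2 : grad (fun zp => K f g A b delta c x (it_y s) zp u v) (it_z s) =
    - grad_aug_lag A b Dg x (it_z s) v.
  apply: (grad_quad_bounds_opp _ g0 (aug_lag_quad_bounds A b L0 mu0 Hg x v)
    (k := aug_lag A b gd x (it_y s) u)) => z; exact: K_split.
transitivity (Iterate
  (eproj (@Py R dy dh) (it_y s - step_y A L mu *:
     grad (fun yp => K f g A b delta c x yp (it_z s) u v) (it_y s)))
  (eproj (@Py R dy dh) (it_z s + step_y A L mu *:
     grad (fun zp => K f g A b delta c x (it_y s) zp u v) (it_z s))) u v).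
  reflexivity.
by rewrite e1 e2 scalerN.
Qed.

Lemma grad_K_outer x yp zp u v : grad (fun w => K f g A b delta c w yp zp u v) x =
  usubmx (Df (col_mx x (usubmx yp))) - usubmx (Dg (col_mx x (usubmx zp))).
Proof.
apply: (grad_quadratic (M := L)) => q; rewrite !K_split /aug_lag dotvBl.
have [h1 _ _] := Hd; have [h2 _ _] := Hg.
have := h1 (col_mx x (usubmx yp)) (col_mx q (usubmx yp)).
have := h2 (col_mx x (usubmx zp)) (col_mx q (usubmx zp)).
rewrite !col_mx_subl !dotv_0col !enorm_0col !ler_norml; lra.
Qed.

Definition merit2 x (s : iterate R dy dh) : R :=
  merit A b gd x (it_y s) (it_u s) + merit A b g x (it_z s) (it_v s).
Definition merit_residual2 x (s : iterate R dy dh) : R :=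
  merit_residual A b gd x (it_y s) (it_u s) + merit_residual A b g x (it_z s) (it_v s).
Definition in_Py (s : iterate R dy dh) : Prop := Py (it_y s) /\ Py (it_z s).

Local Notation step := (sflcb_fixed_step f g A b delta c).

Lemma merit2_decrease x x' s : in_Py s ->
  in_Py (step x s) /\ merit2 x' (step x s) <= merit2 x s
    - step_dec A L mu * merit_residual2 x s + 2 * step_drift A L mu * enorm (x' - x) ^+ 2.
Proof.
have add (m n m' n' r q c e : R) : m' <= m - c * r + e -> n' <= n - c * q + e ->
    m' + n' <= m + n - c * (r + q) + 2 * e by lra.
move=> [Py_ Pz]; rewrite fixed_stepE.
have [h1 h2] := merit_decrease Y0 L0 mu0 Hd x x' (it_u s) Py_.
have [h3 h4] := merit_decrease Y0 L0 mu0 Hg x x' (it_v s) Pz.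
split; first by split; [exact: h1|exact: h3].
by rewrite -[2 * _ * _]mulrA; exact: add h2 h4.
Qed.

Lemma merit_residual2_bounds x s : in_Py s ->
  [/\ 0 <= merit_residual A b gd x (it_y s) (it_u s)
    & 0 <= merit_residual A b g x (it_z s) (it_v s)].
Proof.
move=> [Py_ Pz]; rewrite /merit_residual; split; apply: addr_ge0; rewrite ?sqr_ge0 //.
  exact: (lag_gap_ge0 A b L0 mu0 Hd).
exact: (lag_gap_ge0 A b L0 mu0 Hg).
Qed.

Lemma merit2_ge0 x s : in_Py s -> 0 <= merit2 x s.
Proof.
move=> [Py_ Pz]; rewrite /merit2 /merit.
apply: addr_ge0; apply: addr_ge0.
- exact: (lag_gap_ge0 A b L0 mu0 Hd).
- exact: (weak_duality Y0 L0 mu0 Hd).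
- exact: (lag_gap_ge0 A b L0 mu0 Hg).
exact: (weak_duality Y0 L0 mu0 Hg).
Qed.

(** This is [delta * Phi_delta], see [Phi_deltaE]: the inner maximization is
    solved by [ystar g] and the outer minimization by [ystar gd]. *)
Definition Psi x : R := primal_fun A b gd x - primal_fun A b g x.
Definition grad_Psi x : 'cV[R]_dx :=
  usubmx (Df (col_mx x (ystar gd A b x))) - usubmx (Dg (col_mx x (ystar g A b x))).

Lemma Psi_expansion x x' :
  `|Psi x' - Psi x - dotv (grad_Psi x) (x' - x)| <= 2 * envelope_const A L mu * enorm (x' - x) ^+ 2.
Proof.
have := primal_expansion Y0 L0 mu0 Hd x x'; have := primal_expansion Y0 L0 mu0 Hg x x'.
rewrite /Psi /grad_Psi dotvBl !ler_norml; lra.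
Qed.

Definition primal_error_const : R := 4 / lag_modulus A mu + 2 * error_bound_const A L mu ^+ 2.

Lemma primal_error (G : 'cV[R]_(dx + dy) -> R) D x w u : smooth_sc L mu G D -> Py w ->
  enorm (usubmx w - ystar G A b x) ^+ 2 <= primal_error_const * merit_residual A b G x w u.
Proof.
move=> GD Pw; set w' := w_opt A b G x u.
have gam0 := lag_modulus_gt0 A mu0.
have h1 := lag_gap_growth A b L0 mu0 GD x u Pw; rewrite -/w' in h1.
have h2 := dual_error_bound Y0 L0 mu0 GD x u; rewrite -/w' in h2.
have h3 := enorm_add_sqr_le (usubmx w - usubmx w') (usubmx w' - ystar G A b x).
rewrite addrA subrK in h3.
have h4 : enorm (usubmx w - usubmx w') ^+ 2 <= enorm (w - w') ^+ 2.
  by rewrite ler_pXn2r ?nnegrE ?enorm_ge0 // -linearB enorm_usubmx.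
have h5 : enorm (usubmx w' - ystar G A b x) ^+ 2 <=
    error_bound_const A L mu ^+ 2 * enorm (dual_residual A b G x u) ^+ 2.
  rewrite -exprMn ler_pXn2r ?nnegrE ?enorm_ge0 //.
  by apply: mulr_ge0; [exact: error_bound_const_ge0|exact: enorm_ge0].
have h6 : enorm (w - w') ^+ 2 <= 2 / lag_modulus A mu * lag_gap A b G x w u.
  rewrite -(ler_pM2l (_ : 0 < lag_modulus A mu / 2)) ?divr_gt0 // [leRHS]mulrA.
  have -> : lag_modulus A mu / 2 * (2 / lag_modulus A mu) = 1 by field; rewrite gt_eqF.
  by rewrite mul1r.
have l0 := lag_gap_ge0 A b L0 mu0 GD x u Pw.
have r0 := sqr_ge0 (enorm (dual_residual A b G x u)).
have i0 : 0 <= 4 / lag_modulus A mu by rewrite divr_ge0 // ltW.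
have e0 := sqr_ge0 (error_bound_const A L mu).
have p1 := mulr_ge0 i0 r0; have p2 := mulr_ge0 e0 l0.
rewrite /primal_error_const /merit_residual; lra.
Qed.

Lemma outer_direction_error x s : in_Py s ->
  enorm (grad (fun w => K f g A b delta c w (it_y s) (it_z s) (it_u (step x s))
      (it_v (step x s))) x - grad_Psi x) ^+ 2
  <= 2 * L ^+ 2 * primal_error_const * merit_residual2 x s.
Proof.
move=> [Py_ Pz]; rewrite grad_K_outer.
have e1 := primal_error x (it_u s) Hd Py_.
have e2 := primal_error x (it_v s) Hg Pz.
have lip (D : 'cV[R]_(dx + dy) -> 'cV[R]_(dx + dy)) y y' :
    (forall p q, enorm (D p - D q) <= L * enorm (p - q)) ->
    enorm (usubmx (D (col_mx x y)) - usubmx (D (col_mx x y'))) ^+ 2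
      <= L ^+ 2 * enorm (y - y') ^+ 2.
  move=> DL; rewrite -exprMn ler_pXn2r ?nnegrE ?mulr_ge0 ?enorm_ge0 ?(ltW L0) //.
  rewrite -linearB /=; apply: le_trans (enorm_usubmx _) _.
  by apply: le_trans (DL _ _) _; rewrite col_mx_subr enorm_col0.
have l1 := lip _ (usubmx (it_y s)) (ystar gd A b x) (gradient_lipschitz Hd).
have l2 := lip _ (usubmx (it_z s)) (ystar g A b x) (gradient_lipschitz Hg).
have -> : usubmx (Df (col_mx x (usubmx (it_y s)))) - usubmx (Dg (col_mx x (usubmx (it_z s))))
    - grad_Psi x =
  (usubmx (Df (col_mx x (usubmx (it_y s)))) - usubmx (Df (col_mx x (ystar gd A b x))))
  + - (usubmx (Dg (col_mx x (usubmx (it_z s)))) - usubmx (Dg (col_mx x (ystar g A b x)))).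
  by rewrite /grad_Psi !opprD !opprK addrACA.
apply: le_trans (enorm_add_sqr_le _ _) _; rewrite enormN.
have L2 := sqr_ge0 L.
have m1 := ler_wpM2l L2 e1; have m2 := ler_wpM2l L2 e2.
rewrite /merit_residual2; lra.
Qed.

Hypothesis ex0 : 0 < ex.
Hypothesis ex1 : ex * (2 * (2 * envelope_const A L mu + 2 * step_drift A L mu)) <= 1.
Hypothesis ex2 : ex * (L ^+ 2 * primal_error_const) <= step_dec A L mu.

(** A descent step for [Psi] uses inexact gradients, whose errors are paid for
    by the decrease of [merit2] when [ex] is small. *)
Definition potential (p : 'cV[R]_dx * iterate R dy dh) : R := Psi p.1 + merit2 p.1 p.2.

Lemma potential_decrease p : in_Py p.2 ->
  in_Py (sflcb_step f g A b delta c p).2 /\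
  potential (sflcb_step f g A b delta c p) <=
    potential p - ex / 2 * enorm (grad_Psi p.1) ^+ 2.
Proof.
case: p => x s /= Ps.
set d := grad _ _; rewrite /potential /=; set x' := x - _.
have err := outer_direction_error x Ps; rewrite -/d in err.
have [Ps' dec] := merit2_decrease x x' Ps; split => //.
have := Psi_expansion x x'; rewrite ler_norml => /andP[_ ub].
have xx : x' - x = - (ex *: d) by rewrite /x' addrDK.
rewrite xx enormN enormZ gtr0_norm // in ub dec.
rewrite dotvNr dotvZr in ub.
have cross : dotv (grad_Psi x) d = 1 / 2 * enorm (grad_Psi x) ^+ 2 + 1 / 2 * enorm d ^+ 2
    - 1 / 2 * enorm (d - grad_Psi x) ^+ 2.
  by rewrite enorm_add_sqr enormN dotvNr (dotvC d); lra.
have [q1 q2] := merit_residual2_bounds x Ps.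
have q0 : 0 <= merit_residual2 x s by rewrite addr_ge0.
have m1 := ler_wpM2r q0 ex2.
have m2 := ler_wpM2l (ltW ex0) err.
have m3 := ler_wpM2r (sqr_ge0 (enorm d)) (ler_wpM2l (ltW ex0) ex1).
rewrite cross exprMn in ub dec; lra.
Qed.

Lemma Phi_deltaE x : Phi_delta f g A b delta x = delta^-1 * Psi x.
Proof.
have di : 0 < delta^-1 by rewrite invr_gt0.
have mx y : maxval (feasible A b) (fun z =>
      f (col_mx x y) + delta^-1 * (g (col_mx x y) - g (col_mx x z))) =
    delta^-1 * (gd (col_mx x y) - primal_fun A b g x).
  rewrite /maxval (@argmax_argmin _ _ _ _ (fun z => g (col_mx x z))); last first.
    by move=> y' z; rewrite lerD2l ler_pM2l // lerD2l lerN2.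
  rewrite -/(ystar g A b x) /gdelta /primal_fun; field; rewrite gt_eqF //.
rewrite /Phi_delta /minval (@argmin_ext _ _ _ _ (fun y => gd (col_mx x y))) ?mx //.
by move=> y z; rewrite !mx ler_pM2l // lerD2r.
Qed.

Lemma Phi_delta_stationary eps x : enorm (grad_Psi x) <= delta * eps ->
  stationary eps (Phi_delta f g A b delta) x.
Proof.
move=> h.
have di : 0 < delta^-1 by rewrite invr_gt0.
have expand q : `|Phi_delta f g A b delta q - Phi_delta f g A b delta x
    - dotv (delta^-1 *: grad_Psi x) (q - x)|
    <= delta^-1 * (2 * envelope_const A L mu) * enorm (q - x) ^+ 2.
  rewrite !Phi_deltaE dotvZl -!mulrBr normrM gtr0_norm // -[leRHS]mulrA.
  by rewrite ler_pM2l // Psi_expansion.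
split; first by have [] := quadratic_differentiable expand.
by rewrite (grad_quadratic expand) enormZ gtr0_norm // ler_pdivrMl.
Qed.

Lemma Psi_upper x : Psi x <= delta * Phi f g A b x.
Proof.
have h : gd (col_mx x (ystar gd A b x)) <= gd (col_mx x (ystar g A b x)).
  exact: (ystarP Y0 mu0 Hd x).2 _ (ystarP Y0 mu0 Hg x).1.
by rewrite /Psi /primal_fun lerBlDr; apply: le_trans h _.
Qed.

(** The growth of [g] around [ystar g] limits the gain of moving from [ystar g]
    to [ystar gd], which is linear in the distance because [f] is Lipschitz. *)
Lemma Psi_lower l x : (forall p q, `|f p - f q| <= l * enorm (p - q)) ->
  delta * Phi f g A b x - delta ^+ 2 * (l ^+ 2 / (2 * mu)) <= Psi x.
Proof.
move=> fl.
set y := ystar g A b x; set z := ystar gd A b x.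
have gr := argmin_growth (objective_quad_bounds Hg x) (@feasible_segment _ _ _ A b)
  (ystarP Y0 mu0 Hg x) (ystarP Y0 mu0 Hd x).1.
cbv beta in gr; rewrite -/y -/z in gr.
have := fl (col_mx x y) (col_mx x z).
rewrite col_mx_subr enorm_col0 enormB ler_norml => /andP[_ h1].
rewrite /Psi /primal_fun -/y -/z /gdelta /Phi -/y.
have h2 := ler_wpM2l (ltW delta0) h1.
have h3 := sqr_ge0 (delta * l - mu * enorm (z - y)).
have m2 : 0 < 2 * mu by rewrite mulr_gt0.
have h4 : delta * l * enorm (z - y) <=
    mu / 2 * enorm (z - y) ^+ 2 + delta ^+ 2 * (l ^+ 2 / (2 * mu)).
  rewrite -(ler_pM2l m2).
  have -> : 2 * mu * (mu / 2 * enorm (z - y) ^+ 2 + delta ^+ 2 * (l ^+ 2 / (2 * mu))) =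
    mu ^+ 2 * enorm (z - y) ^+ 2 + delta ^+ 2 * l ^+ 2 by field; rewrite gt_eqF.
  lra.
lra.
Qed.

End Algorithm.

(** * The objectives g and delta f + g *)

Section FirstOrder.
Context {R : realType}.

(** Divide the inequality at parameter [t] by [t] and let [t] tend to [0]. *)
Lemma strongly_convex_first_order n mu M (F : 'cV[R]_n -> R) DF y z :
  strongly_convex mu F ->
  (forall q, `|F q - F y - dotv DF (q - y)| <= M * enorm (q - y) ^+ 2) ->
  F y + dotv DF (z - y) + mu / 2 * enorm (z - y) ^+ 2 <= F z.
Proof.
move=> sc FD; set N := enorm (z - y) ^+ 2.
apply: (@le_of_small_perturbation _ _ _ ((M + mu / 2) * N)) => t t0 t1.
have := sc z y t; rewrite (ltW t0) t1 => /(_ isT) h1.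
have e : t *: z + (1 - t) *: y = y + t *: (z - y).
  by rewrite scalerBl scale1r scalerBr addrCA.
have := FD (y + t *: (z - y)); rewrite addrDK dotvZr enormZ (gtr0_norm t0) ler_norml => /andP[h2 _].
rewrite e -/N in h1; rewrite exprMn -/N in h2.
rewrite -(ler_pM2l t0); lra.
Qed.

End FirstOrder.

Section Smoothness.
Context {R : realType} {dx dy : nat}.
Variables (f g : 'cV[R]_(dx + dy) -> R) (lf1 lg1 mu : R).
Hypothesis f_C1 : cont_diff f.
Hypothesis g_C1 : cont_diff g.
Hypothesis lf1_gt0 : 0 < lf1.
Hypothesis gradf_lip : forall p q, enorm (grad f p - grad f q) <= lf1 * enorm (p - q).
Hypothesis gradg_lip : forall p q, enorm (grad g p - grad g q) <= lg1 * enorm (p - q).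
Hypothesis mu_gt0 : 0 < mu.
Hypothesis g_sconvex : forall x, strongly_convex mu (fun y => g (col_mx x y)).

(** A smoothness constant valid for [g] and for all [delta f + g] with
    [delta <= mu / (2 lf1)]. *)
Definition smooth_const : R := mu / 2 + `|lg1| + 1.

Lemma smooth_const_gt0 : 0 < smooth_const.
Proof. by rewrite ltr_wpDl // addr_ge0 // divr_ge0 // ltW. Qed.

Let f_exp := descent_lemma f_C1.1 gradf_lip.
Let g_exp := descent_lemma g_C1.1 gradg_lip.

Lemma g_first_order x y y' :
  g (col_mx x y) + dotv (dsubmx (grad g (col_mx x y))) (y' - y)
    + mu / 2 * enorm (y' - y) ^+ 2 <= g (col_mx x y').
Proof.
have h q : `|g (col_mx x q) - g (col_mx x y) - dotv (dsubmx (grad g (col_mx x y))) (q - y)|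
    <= lg1 / 2 * enorm (q - y) ^+ 2.
  by have := g_exp (col_mx x y) (col_mx x q); rewrite col_mx_subr enorm_col0 dotv_col0.
exact: (@strongly_convex_first_order _ _ mu (lg1 / 2) (fun y => g (col_mx x y)) _ y y'
  (g_sconvex x) h).
Qed.

Lemma g_smooth_sc : smooth_sc smooth_const (mu / 2) g (grad g).
Proof.
have mu0 := mu_gt0; have n0 := normr_ge0 lg1; have ln := ler_norm lg1.
have lL : lg1 <= smooth_const by rewrite /smooth_const; lra.
split=> [p q|p q|x y y'].
- apply: le_trans (g_exp p q) _; have := ler_wpM2r (sqr_ge0 (enorm (q - p))) lL; lra.
- by apply: le_trans (gradg_lip p q) _; rewrite ler_wpM2r ?enorm_ge0.
have h := g_first_order x y y'.
have e := mulr_ge0 (ltW mu_gt0) (sqr_ge0 (enorm (y' - y))); lra.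
Qed.

(** The curvature of [delta f] is at least [- delta * lf1 >= - mu / 2], which
    leaves half of the strong convexity of [g]. *)
Lemma gdelta_smooth_sc delta : 0 < delta -> delta <= mu / (2 * lf1) ->
  smooth_sc smooth_const (mu / 2) (gdelta f g delta) (fun p => delta *: grad f p + grad g p).
Proof.
move=> d0; rewrite ler_pdivlMr ?mulr_gt0 // => d1.
have mu0 := mu_gt0; have n0 := normr_ge0 lg1; have ln := ler_norm lg1.
have dL : delta * lf1 + lg1 <= smooth_const by rewrite /smooth_const; lra.
split=> [p q|p q|x y y'].
- have h1 := f_exp p q; have h2 := g_exp p q.
  have h3 := ler_wpM2r (sqr_ge0 (enorm (q - p))) dL.
  have -> : gdelta f g delta q - gdelta f g delta p - dotv (delta *: grad f p + grad g p) (q - p)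
    = delta * (f q - f p - dotv (grad f p) (q - p)) + (g q - g p - dotv (grad g p) (q - p)).
    by rewrite /gdelta dotvDl dotvZl; ring.
  apply: le_trans (ler_normD _ _) _; rewrite normrM gtr0_norm //.
  have := ler_wpM2l (ltW d0) h1; lra.
- have -> : delta *: grad f p + grad g p - (delta *: grad f q + grad g q) =
    delta *: (grad f p - grad f q) + (grad g p - grad g q).
    by rewrite opprD addrACA scalerBr.
  apply: le_trans (enormD _ _) _; rewrite enormZ gtr0_norm //.
  have h1 := ler_wpM2l (ltW d0) (gradf_lip p q); have h2 := gradg_lip p q.
  apply: le_trans (lerD h1 h2) _; rewrite mulrA -mulrDl.
  by rewrite ler_wpM2r ?enorm_ge0.
have h := g_first_order x y y'.
have := f_exp (col_mx x y) (col_mx x y').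
rewrite col_mx_subr enorm_col0 dotv_col0 ler_norml => /andP[h1 _].
have h2 := ler_wpM2l (ltW d0) h1.
have h3 := ler_wpM2r (sqr_ge0 (enorm (y' - y))) d1.
rewrite (linearD dsubmx) linearZ /= dotvDl dotvZl /gdelta; lra.
Qed.

End Smoothness.

(** * Complexity of the two phases *)

Section Telescoping.
Context {R : realType}.

(** The first [N] decrements add up to at most [V 0 - m], so one of them is at
    most their average. *)
Lemma telescoping_pick (V q : nat -> R) m N :
  (forall t, V t.+1 <= V t - q t) -> (forall t, m <= V t) ->
  (0 < N)%N -> exists2 t, (t < N)%N & N%:R * q t <= V 0%N - m.
Proof.
move=> Vdec Vm N0; apply: contrapT => hn.
have h t : (t < N)%N -> V 0%N - m < N%:R * q t.
  by move=> tN; rewrite ltNge; apply/negP => h; apply: hn; exists t.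
have dec j : (j <= N)%N -> N%:R * V j <= N%:R * V 0%N - j%:R * (V 0%N - m).
  elim: j => [_|j IH jN]; first by rewrite mul0r subr0.
  have h1 := ler_wpM2l (ler0n R N) (Vdec j); have h2 := IH (ltnW jN).
  by rewrite -natr1; have := h j jN; lra.
have N0' : 0 < N%:R :> R by rewrite ltr0n.
case: N N0 N0' h {hn} dec => // N _ N0' h dec.
have h1 := ler_wpM2l (ltW N0') (Vdec N).
have h2 := ler_wpM2l (ltW N0') (Vm N.+1); have h3 := dec N (leqnSn N).
have h4 := h N (ltnSn N).
by rewrite -natr1 in h1 h2 h3 h4 N0'; lra.
Qed.

End Telescoping.

Lemma trunc_bound (R : realType) (k : R) : 0 <= k ->
  exists2 N : nat, (0 < N)%N & k <= N%:R /\ forall t, (t < N)%N -> t%:R <= k.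
Proof.
move=> k0; have /andP[h1 h2] := truncn_itv k0.
exists (Num.Def.trunc k).+1 => //; split; first exact: ltW.
by move=> t; rewrite ltnS => tN; apply: le_trans h1; rewrite ler_nat.
Qed.

Section Phases.
Context {R : realType} {dx dy dh : nat}.
Variables (f g : 'cV[R]_(dx + dy) -> R) (A : 'M[R]_(dh, dy)) (b : 'cV[R]_dh).
Variables (Df Dg : 'cV[R]_(dx + dy) -> 'cV[R]_(dx + dy)).
Variables (L mu delta : R).
Hypothesis Y0 : feasible A b !=set0.
Hypothesis L0 : 0 < L.
Hypothesis mu0 : 0 < mu.
Hypothesis delta0 : 0 < delta.

Local Notation gd := (gdelta f g delta).

Hypothesis Hd : smooth_sc L mu gd Df.
Hypothesis Hg : smooth_sc L mu g Dg.

Variable ex : R.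
Hypothesis ex0 : 0 < ex.
Hypothesis ex1 : ex * (2 * (2 * envelope_const A L mu + 2 * step_drift A L mu)) <= 1.
Hypothesis ex2 : ex * (L ^+ 2 * primal_error_const A L mu) <= step_dec A L mu.
Local Notation c := (sflcb_choice A L mu ex).
Local Notation step := (sflcb_fixed_step f g A b delta c).

Lemma fixed_run_in_Py x s t : in_Py s -> in_Py (iter t (step x) s).
Proof.
move=> Ps; elim: t => // t IH; rewrite iterS.
by have [] := merit2_decrease Y0 L0 mu0 Hd Hg ex x x IH.
Qed.

(** [merit2] is nonnegative and each iteration lowers it by [merit_residual2],
    up to a factor, so some residual is at most the average. *)
Lemma fixed_phase x s E0 vs eps : in_Py s -> merit2 f g A b delta x s <= E0 ->
  0 < vs -> 0 < eps ->
  exists2 T : nat, T%:R <= E0 / (step_dec A L mu * vs ^+ 2) * eps ^- 2 &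
    merit_residual2 f g A b delta x (iter T (step x) s) <= (vs * eps) ^+ 2.
Proof.
move=> Ps sE vs0 e0; have dec0 := step_dec_gt0 A L0 mu0.
pose V t := merit2 f g A b delta x (iter t (step x) s).
pose q t := step_dec A L mu * merit_residual2 f g A b delta x (iter t (step x) s).
have Vdec t : V t.+1 <= V t - q t.
  have [_] := merit2_decrease Y0 L0 mu0 Hd Hg ex x x (fixed_run_in_Py x t Ps).
  by rewrite subrr enorm0 expr0n mulr0 addr0 -iterS.
have V0 t : 0 <= V t := merit2_ge0 Y0 L0 mu0 Hd Hg x (fixed_run_in_Py x t Ps).
set k := E0 / _ * _.
have E00 : 0 <= E0 := le_trans (V0 0%N) sE.
have k0 : 0 <= k.
  by rewrite mulr_ge0 ?invr_ge0 ?exprn_ge0 ?(ltW e0) // divr_ge0 // ltW // mulr_gt0 // exprn_gt0.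
have [N N0 [kN tk]] := trunc_bound k0.
have [T TN qT] := telescoping_pick Vdec V0 N0.
exists T; first exact: tk.
have N0' : 0 < N%:R :> R by rewrite ltr0n.
rewrite subr0 in qT.
rewrite -(ler_pM2l dec0) -(ler_pM2l N0').
apply: le_trans qT (le_trans sE _).
have -> : E0 = k * (step_dec A L mu * (vs * eps) ^+ 2).
  by rewrite /k; field; rewrite !gt_eqF.
by rewrite ler_wpM2r // mulr_ge0 ?sqr_ge0 // ltW.
Qed.

Lemma run_in_Py p t : in_Py p.2 -> in_Py (iter t (sflcb_step f g A b delta c) p).2.
Proof.
move=> Ps; elim: t => // t IH; rewrite iterS.
by have [] := potential_decrease Y0 L0 mu0 Hd Hg ex0 ex1 ex2 IH.
Qed.

(** The potential drops in total by at most [delta * H], and each iteration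
    lowers it by [ex / 2 * |grad_Psi|^2]; since [|grad_Psi| <= delta * eps] is
    sought, [H / (delta * eps^2)] iterations are needed. *)
Lemma outer_phase p m H c1 eps : in_Py p.2 -> (forall x, m <= Psi f g A b delta x) ->
  potential f g A b delta p - m <= delta * H -> 0 < c1 -> 0 < eps -> c1 * eps <= delta ->
  exists2 t : nat, t%:R <= 2 * H / (ex * c1) * eps ^- 3 &
    enorm (grad_Psi f g A b Df Dg delta (iter t (sflcb_step f g A b delta c) p).1)
      <= delta * eps.
Proof.
move=> Pp mPsi pH c10 e0 ce.
pose it t := iter t (sflcb_step f g A b delta c) p.
pose V t := potential f g A b delta (it t).
pose q t := ex / 2 * enorm (grad_Psi f g A b Df Dg delta (it t).1) ^+ 2.
have Vdec t : V t.+1 <= V t - q t.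
  by have [_] := potential_decrease Y0 L0 mu0 Hd Hg ex0 ex1 ex2 (run_in_Py t Pp).
have Vm t : m <= V t.
  rewrite -[m]addr0; apply: lerD; first exact: mPsi.
  exact: (merit2_ge0 Y0 L0 mu0 Hd Hg _ (run_in_Py t Pp)).
have H0 : 0 <= H by rewrite -(pmulr_rge0 _ delta0) (le_trans _ pH) // subr_ge0; exact: (Vm 0%N).
set k := 2 * H / _ * _.
have k0 : 0 <= k.
  apply: mulr_ge0; last by rewrite invr_ge0 exprn_ge0 // ltW.
  by rewrite divr_ge0 ?mulr_ge0 // ltW.
have [N N0 [kN tk]] := trunc_bound k0.
have [t tN qt] := telescoping_pick Vdec Vm N0.
exists t; first exact: tk.
have N0' : 0 < N%:R :> R by rewrite ltr0n.
apply: enorm_le; first by rewrite mulr_ge0 // ltW.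
have ex20 : 0 < ex / 2 by rewrite divr_gt0.
rewrite dotv_self -(ler_pM2l ex20) -(ler_pM2l N0').
apply: le_trans qt (le_trans pH _).
have h1 : k * (ex / 2 * (delta * eps) ^+ 2) = H * delta * (delta / (c1 * eps)).
  by rewrite /k; field; rewrite !gt_eqF.
apply: (@le_trans _ _ (k * (ex / 2 * (delta * eps) ^+ 2))); last first.
  by rewrite ler_wpM2r // mulr_ge0 ?sqr_ge0 // ltW.
rewrite h1 [delta * H]mulrC ler_peMr ?mulr_ge0 ?(ltW delta0) //.
by rewrite ler_pdivlMr ?mulr_gt0 // mul1r.
Qed.

Lemma yp_starE x u : yp_star f g A b delta c x u = w_opt A b gd x u.
Proof. by apply: argmin_ext => y z; rewrite !K_split lerD2r. Qed.

Lemma zp_starE x v : zp_star f g A b delta c x v = w_opt A b g x v.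
Proof. by apply: argmax_argmin => y z; rewrite !K_split lerD2l lerN2. Qed.

End Phases.

Section InitialBound.
Context {R : realType} {dx dy dh : nat}.
Variables (f g : 'cV[R]_(dx + dy) -> R) (A : 'M[R]_(dh, dy)) (b : 'cV[R]_dh).
Variables (Df Dg : 'cV[R]_(dx + dy) -> 'cV[R]_(dx + dy)) (L mu : R).
Hypothesis Y0 : feasible A b !=set0.
Hypothesis L0 : 0 < L.
Hypothesis mu0 : 0 < mu.
Hypothesis Hg : smooth_sc L mu g Dg.
Variable dmax : R.

(** Bounds [lag_gap_le_grad] for all [delta <= dmax] at once. *)
Definition gap_bound x w u : R :=
  (enorm (grad_aug_lag A b Dg x w u) + dmax * enorm (Df (col_mx x (usubmx w)))) ^+ 2
    / (2 * lag_modulus A mu).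

Definition merit_bound x y w u : R :=
  gap_bound x w u + gap_bound x (col_mx y (A *m y - b)) u.

Lemma lag_gap_le_bound delta x w u : 0 <= delta -> delta <= dmax ->
  smooth_sc L mu (gdelta f g delta) (fun p => delta *: Df p + Dg p) ->
  lag_gap A b (gdelta f g delta) x w u <= gap_bound x w u.
Proof.
move=> d0 dm Hd; apply: le_trans (lag_gap_le_grad A b L0 mu0 Hd x w u) _.
rewrite ler_wpM2r ?invr_ge0 ?mulr_ge0 ?(ltW (lag_modulus_gt0 A mu0)) //.
have dm0 : 0 <= dmax := le_trans d0 dm.
rewrite ler_pXn2r ?nnegrE ?addr_ge0 ?mulr_ge0 ?enorm_ge0 //.
have -> : grad_aug_lag A b (fun p => delta *: Df p + Dg p) x w u =
    grad_aug_lag A b Dg x w u + col_mx (dsubmx (delta *: Df (col_mx x (usubmx w)))) 0.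
  rewrite /grad_aug_lag [RHS]addrAC add_col_mx addr0; congr (col_mx _ _ + _).
  by rewrite (linearD dsubmx) addrC.
apply: le_trans (enormD _ _) _; rewrite lerD2l enorm_0col.
apply: le_trans (enorm_dsubmx _) _; rewrite enormZ ger0_norm //.
by rewrite ler_wpM2r ?enorm_ge0.
Qed.

Lemma merit_le_bound delta x y w u : 0 <= delta -> delta <= dmax -> feasible A b y ->
  smooth_sc L mu (gdelta f g delta) (fun p => delta *: Df p + Dg p) ->
  merit A b (gdelta f g delta) x w u <= merit_bound x y w u.
Proof.
move=> d0 dm Yy Hd; apply: lerD; first exact: lag_gap_le_bound.
apply: le_trans (dual_gap_le_lag_gap Y0 mu0 Hd x u Yy) _.
exact: lag_gap_le_bound.
Qed.

Lemma merit_le_bound0 x y w u : 0 <= dmax -> feasible A b y ->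
  merit A b g x w u <= merit_bound x y w u.
Proof.
move=> dm Yy.
have gE : gdelta f g 0 = g by apply/funext => p; rewrite /gdelta mul0r add0r.
have DE : (fun p => 0 *: Df p + Dg p) = Dg by apply/funext => p; rewrite scale0r add0r.
have Hd : smooth_sc L mu (gdelta f g 0) (fun p => 0 *: Df p + Dg p) by rewrite gE DE.
by have := merit_le_bound x w u (lexx 0) dm Yy Hd; rewrite gE.
Qed.

End InitialBound.

(** * The complexity theorem *)

(** With the multiplier known up to [k * t], the dual gap is of second order. *)
Lemma merit_le_accuracy (R : realType) (dx dy dh : nat) (A : 'M[R]_(dh, dy)) b L mu
    (G : 'cV[R]_(dx + dy) -> R) D x w u t k :
  feasible A b !=set0 -> 0 < L -> 0 < mu -> smooth_sc L mu G D -> 0 <= k ->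
  merit_residual A b G x w u <= t ^+ 2 ->
  enorm (dual_residual A b G x u) <= k * t -> enorm (u - multiplier G A b x) <= k * t ->
  merit A b G x w u <= (1 + k ^+ 2) * t ^+ 2.
Proof.
move=> Y0 L0 mu0 GD k0 small r1 u1; rewrite /merit mulrDl mul1r; apply: lerD.
  by apply: le_trans small; rewrite lerDl sqr_ge0.
apply: le_trans (dual_gap_le_multiplier Y0 L0 mu0 GD x u) _.
by rewrite -exprMn expr2; apply: ler_pM; rewrite ?enorm_ge0.
Qed.

Lemma ereal_inf_lower (R : realType) T (F : T -> R) :
  (-oo < ereal_inf [set (F x)%:E | x in [set: T]])%E -> exists m, forall x, m <= F x.
Proof.
move=> h.
have lb x : (ereal_inf [set (F x)%:E | x in [set: T]] <= (F x)%:E)%E.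
  by apply: ereal_inf_lbound; exists x.
move: h lb; case: (ereal_inf _) => [r||] // _ lb; first by exists r.
by exists 0 => x; have := lb x; rewrite leye_eq.
Qed.

Lemma inactive_gap_le (R : realType) dy dh (A : 'M[R]_(dh, dy)) b y i :
  i \notin active A b y -> (inactive_gap A b y <= `|slack A b y i 0|%:E)%E.
Proof.
by move=> iJ; apply: bigmin_le_cond; rewrite inE.
Qed.

Theorem corollary5p5 (R : realType) (dx dy dh : nat)
  (f g : 'cV[R]_(dx + dy) -> R) (A : 'M[R]_(dh, dy)) (b : 'cV[R]_dh)
  (lf0 lf1 lg1 mu c1 c2 : R) (x0 : 'cV[R]_dx)
  (f_C1 : cont_diff f) (g_C1 : cont_diff g)
  (* (S1) *)
  (Y_neq0 : feasible A b !=set0)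
  (Y_closed : closed (feasible A b))
  (Y_convex : convex_set (feasible A b))
  (Phi_bounded : (-oo < ereal_inf [set (Phi f g A b x)%:E | x in [set: 'cV[R]_dx]])%E)
  (* (S2) *)
  (lf1_gt0 : 0 < lf1)
  (f_lip : forall p q, `|f p - f q| <= lf0 * enorm (p - q))
  (gradf_lip : forall p q, enorm (grad f p - grad f q) <= lf1 * enorm (p - q))
  (gradg_lip : forall p q, enorm (grad g p - grad g q) <= lg1 * enorm (p - q))
  (* (S3) *)
  (mu_gt0 : 0 < mu)
  (g_sconvex : forall x, strongly_convex mu (fun y => g (col_mx x y)))
  (c1_gt0 : 0 < c1) (c1_le_c2 : c1 <= c2)
  (licq0 : licq A b (ystar g A b x0)) :
  exists (c : sflcb_params R) (kappa : R),
    [/\ params_pos c, 0 < kappa &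
    forall s0 : iterate R dy dh, Py (it_y s0) -> Py (it_z s0) ->
    exists C : R, 0 < C /\
    forall eps delta : R, 0 < eps ->
      c1 * eps <= delta <= c2 * eps ->
      delta <= mu / (2 * lf1) ->
      let gd := gdelta f g delta in
      licq A b (ystar gd A b x0) ->
      (eps%:E <= kappa%:E * Order.min (inactive_gap A b (ystar gd A b x0))
                                      (inactive_gap A b (ystar g A b x0)))%E ->
      exists T t : nat,
        let hat := iter T (sflcb_fixed_step f g A b delta c x0) s0 in
        let x_t := (iter t (sflcb_step f g A b delta c) (x0, hat)).1 in
        [/\ (* (a) *)
            [/\ T%:R <= C * eps ^- 2,
                [/\ enorm (usubmx (it_y hat) - ystar gd A b x0) <= C * delta,
                    enorm (residual A b (yp_star f g A b delta c x0 (it_u hat)))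
                      <= C * delta,
                    enorm (residual A b (it_y hat)) <= C * delta
                  & enorm (it_u hat - multiplier gd A b x0) <= C * delta]
              & [/\ enorm (usubmx (it_z hat) - ystar g A b x0) <= C * delta,
                    enorm (residual A b (zp_star f g A b delta c x0 (it_v hat)))
                      <= C * delta,
                    enorm (residual A b (it_z hat)) <= C * delta
                  & enorm (it_v hat - multiplier g A b x0) <= C * delta]],
            (* (b) *)
            t%:R <= C * eps ^- 3 /\
              stationary eps (Phi_delta f g A b delta) x_t
          & (T + t)%:R <= C * eps ^- 3]].
Proof.
pose L := smooth_const lg1 mu; pose m2 := mu / 2.
have L0 : 0 < L := smooth_const_gt0 lg1 mu_gt0.
have m20 : 0 < m2 by rewrite divr_gt0.
have Hg : smooth_sc L m2 g (grad g) := g_smooth_sc g_C1 gradg_lip mu_gt0 g_sconvex.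
(* [B] and [Z] are the quantities that limit the outer step in
   [potential_decrease] *)
pose B := 2 * (2 * envelope_const A L m2 + 2 * step_drift A L m2).
pose Z := L ^+ 2 * primal_error_const A L m2.
pose dec := step_dec A L m2.
have dec0 : 0 < dec := step_dec_gt0 A L0 m20.
pose ex := Order.min (`|B| + 1)^-1 (dec / (`|Z| + 1)).
have B1 : 0 < `|B| + 1 by rewrite ltr_wpDl.
have Z1 : 0 < `|Z| + 1 by rewrite ltr_wpDl.
have ex0 : 0 < ex by rewrite lt_min invr_gt0 B1 divr_gt0.
have ex1 : ex * B <= 1.
  apply: (@le_trans _ _ (ex * (`|B| + 1))).
    by rewrite ler_pM2l // (le_trans (ler_norm B)) // lerDl.
  by rewrite -ler_pdivlMr // mul1r ge_min lexx.
have ex2 : ex * Z <= dec.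
  apply: (@le_trans _ _ (ex * (`|Z| + 1))).
    by rewrite ler_pM2l // (le_trans (ler_norm Z)) // lerDl.
  by rewrite -ler_pdivlMr // ge_min lexx orbT.
exists (sflcb_choice A L m2 ex), 1; split => //.
  split => //=; split; first exact: step_y_gt0.
  - exact: step_y_gt0.
  - exact: step_u_gt0.
  exact: step_u_gt0.
set c := sflcb_choice A L m2 ex.
move=> s0 Py0 Pz0.
have [m mPhi] := ereal_inf_lower Phi_bounded.
have [yf Yf] := Y_neq0.
pose dmax := mu / (2 * lf1).
have dmax0 : 0 <= dmax by rewrite divr_ge0 ?mulr_ge0 // ltW.
(* [c1 * eps <= delta <= dmax] keeps [eps] below [emax], which lets lower
   powers of [1 / eps] be absorbed into higher ones *)
pose emax := dmax / c1.
pose bound w u := merit_bound A b (grad f) (grad g) m2 dmax x0 yf w u.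
pose E0 := bound (it_y s0) (it_u s0) + bound (it_z s0) (it_v s0).
pose vs := id_const A L m2; pose acc := acc_const A L m2.
have vs0 : 0 < vs := id_const_gt0 A L0 m20.
have acc0 : 0 < acc := acc_const_gt0 A L0 m20.
(* [KA] and [KB] are the constants of [fixed_phase] and [outer_phase]; [H]
   bounds, relative to [delta], the initial potential above its infimum *)
pose KA := E0 / (dec * vs ^+ 2).
pose H := (Phi f g A b x0 - m) + dmax * (lf0 ^+ 2 / (2 * m2))
  + 2 * (1 + acc ^+ 2) * vs ^+ 2 * (emax / c1).
pose KB := 2 * H / (ex * c1).
pose C := 1 + `|KA| + `|KB| + `|KA| * emax + acc * vs / c1.
have emax0 : 0 <= emax by rewrite divr_ge0 // ltW.
have accvs0 : 0 <= acc * vs / c1 by rewrite divr_ge0 ?mulr_ge0 // ltW.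
have KAe0 : 0 <= `|KA| * emax by rewrite mulr_ge0.
have nA := normr_ge0 KA; have nB := normr_ge0 KB.
have lA := ler_norm KA; have lB := ler_norm KB.
have C1 : 1 <= C by rewrite /C; lra.
have C2 : `|KA| <= C by rewrite /C; lra.
have C3 : `|KB| <= C by rewrite /C; lra.
have C4 : `|KA| * emax + `|KB| <= C by rewrite /C; lra.
have C5 : acc * vs / c1 <= C by rewrite /C; lra.
exists C; split; first exact: lt_le_trans C1.
clearbody C.
move=> eps delta e0 /andP[ce _] dm gd licqd gap.
have d0 : 0 < delta by apply: lt_le_trans ce; rewrite mulr_gt0.
have Hd := gdelta_smooth_sc f_C1 g_C1 lf1_gt0 gradf_lip gradg_lip mu_gt0 g_sconvex d0 dm.
rewrite -/gd -/L -/m2 in Hd.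
have ed : eps <= delta / c1 by rewrite ler_pdivlMr // mulrC.
have ee : eps <= emax by apply: le_trans ed _; rewrite ler_wpM2r ?invr_ge0 // ltW.
rewrite mul1e in gap.
have gapd i : i \notin active A b (ystar gd A b x0) -> eps <= `|slack A b (ystar gd A b x0) i 0|.
  move=> iJ; rewrite -lee_fin; apply: le_trans gap _; apply: le_trans _ (inactive_gap_le iJ).
  by rewrite ge_min lexx.
have gapg i : i \notin active A b (ystar g A b x0) -> eps <= `|slack A b (ystar g A b x0) i 0|.
  move=> iJ; rewrite -lee_fin; apply: le_trans gap _; apply: le_trans _ (inactive_gap_le iJ).
  by rewrite ge_min lexx orbT.
have Ps0 : in_Py s0 by [].
have E0b : merit2 f g A b delta x0 s0 <= E0.
  apply: lerD; first exact: (merit_le_bound Y_neq0 L0 m20 _ _ _ (ltW d0) dm Yf Hd).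
  exact: (@merit_le_bound0 R dx dy dh f g A b (grad f) (grad g) L m2 Y_neq0 L0 m20 Hg dmax x0 yf).
have [T TK small] := fixed_phase Y_neq0 L0 m20 Hd Hg ex Ps0 E0b vs0 e0.
rewrite -/c -/dec -/KA in TK small.
set hat := iter T _ s0 in small.
have Ph : in_Py hat := fixed_run_in_Py Y_neq0 L0 m20 Hd Hg ex x0 T Ps0.
have [nd ng] := merit_residual2_bounds A b L0 m20 Hd Hg x0 Ph.
have smalld : merit_residual A b gd x0 (it_y hat) (it_u hat) <= (vs * eps) ^+ 2.
  by apply: le_trans small; rewrite lerDl.
have smallg : merit_residual A b g x0 (it_z hat) (it_v hat) <= (vs * eps) ^+ 2.
  by apply: le_trans small; rewrite lerDr.
have [y1 y2 y3 y4] := block_accuracy Y_neq0 L0 m20 Hd Ph.1 e0 licqd gapd smalld.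
have [z1 z2 z3 z4] := block_accuracy Y_neq0 L0 m20 Hg Ph.2 e0 licq0 gapg smallg.
have md := merit_le_accuracy Y_neq0 L0 m20 Hd (ltW acc0) smalld y2 y4.
have mg := merit_le_accuracy Y_neq0 L0 m20 Hg (ltW acc0) smallg z2 z4.
have tC z : z <= acc * (vs * eps) -> z <= C * delta.
  move/le_trans; apply; apply: (@le_trans _ _ (acc * vs / c1 * delta)).
    by rewrite mulrA -[leRHS]mulrA [c1^-1 * _]mulrC ler_pM2l // mulr_gt0.
  by rewrite ler_wpM2r // ltW.
have pot : potential f g A b delta (x0, hat)
    - (delta * m - delta ^+ 2 * (lf0 ^+ 2 / (2 * m2))) <= delta * H.
  have p1 := Psi_upper Y_neq0 m20 Hd Hg x0.
  have sq0 : 0 <= lf0 ^+ 2 / (2 * m2) by rewrite divr_ge0 ?sqr_ge0 // mulr_ge0 // ltW.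
  have p2 : delta ^+ 2 * (lf0 ^+ 2 / (2 * m2)) <= delta * (dmax * (lf0 ^+ 2 / (2 * m2))).
    by rewrite expr2 -mulrA ler_pM2l // ler_wpM2r.
  have p3 : 2 * ((1 + acc ^+ 2) * (vs * eps) ^+ 2) <=
      delta * (2 * (1 + acc ^+ 2) * vs ^+ 2 * (emax / c1)).
    have e2 : eps ^+ 2 <= delta * (emax / c1).
      have -> : delta * (emax / c1) = delta / c1 * emax by ring.
      by rewrite expr2; apply: ler_pM => //; exact: ltW.
    have k0 : 0 <= 2 * (1 + acc ^+ 2) * vs ^+ 2.
      by apply: mulr_ge0; [apply: mulr_ge0; rewrite ?addr_ge0 ?sqr_ge0|rewrite sqr_ge0].
    rewrite [leLHS](_ : _ = 2 * (1 + acc ^+ 2) * vs ^+ 2 * eps ^+ 2); last by ring.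
    by rewrite [leRHS]mulrCA ler_wpM2l.
  have p4 : merit2 f g A b delta x0 hat <= 2 * ((1 + acc ^+ 2) * (vs * eps) ^+ 2).
    by rewrite mulr_natl mulr2n; exact: lerD md mg.
  rewrite /potential /= /H; move: p1 p2 p3 p4; clear; lra.
have mPsi x : delta * m - delta ^+ 2 * (lf0 ^+ 2 / (2 * m2)) <= Psi f g A b delta x.
  apply: le_trans (Psi_lower Y_neq0 m20 d0 Hd Hg x f_lip).
  by rewrite lerD2r ler_pM2l.
have [t tK st] := outer_phase (p := (x0, hat)) Y_neq0 L0 m20 d0 Hd Hg ex0 ex1 ex2 Ph mPsi pot c1_gt0 e0 ce.
exists T, t => /=; rewrite -/c -/hat in st *.
have e2i : 0 < eps ^- 2 by rewrite invr_gt0 exprn_gt0.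
have e3i : 0 < eps ^- 3 by rewrite invr_gt0 exprn_gt0.
have TA : T%:R <= `|KA| * eps ^- 2 by apply: le_trans TK _; rewrite ler_pM2r.
have tB : t%:R <= `|KB| * eps ^- 3 by apply: le_trans tK _; rewrite ler_pM2r.
split.
- split.
  + by apply: le_trans TA _; rewrite ler_pM2r.
  + by rewrite yp_starE; split; [exact: tC y1|exact: tC y2|exact: tC y3|exact: tC y4].
  + by rewrite zp_starE; split; [exact: tC z1|exact: tC z2|exact: tC z3|exact: tC z4].
- split; first by apply: le_trans tB _; rewrite ler_pM2r.
  exact: (Phi_delta_stationary Y_neq0 L0 m20 d0 Hd Hg).
rewrite natrD; apply: (@le_trans _ _ ((`|KA| * emax + `|KB|) * eps ^- 3)); last first.
  by rewrite ler_pM2r.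
rewrite mulrDl; apply: lerD => //; apply: le_trans TA _.
rewrite -mulrA ler_wpM2l //.
have -> : eps ^- 2 = eps * eps ^- 3 by field; rewrite gt_eqF.
by rewrite ler_pM2r.
Qed.
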